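(* Let $\pi:M\to B$ be a principal bundle with structure group a Lie group $G$, where $M$ is connected and endowed with a complete $G$-invariant Riemannian metric of nonnegative sectional curvature, and $B$ carries the metric for which $\pi$ is a Riemannian submersion. If for some point $p\in M$ the linear map $\widetilde{A}_p:\Lambda^2(\mathcal{H}_p)\to\mathcal{V}_p$ induced by the O'Neill tensor of $\pi$ is onto, then the submersion $\pi$ is twisted.
   Context: A Riemannian submersion $\pi:M\to B$ induces an orthogonal splitting $TM=\mathcal{H}\oplus\mathcal{V}$, with $\mathcal{V}=\ker\pi_*$ the vertical and $\mathcal{H}$ the horizontal distribution; $z^{\mathbf v}$ denotes the vertical component of $z\in TM$. The O'Neill tensor at $p\in M$ is $A:\mathcal{H}_p\times\mathcal{H}_p\to\mathcal{V}_p$, $A_xy=[X,Y]^{\mathbf v}(p)$, where $X,Y$ are horizontal extensions of $x,y$ to a neighborhood of $p$. Since $A$ is antisymmetric, it induces a linear map $\widetilde{A}_p:\Lambda^2(\mathcal{H}_p)\to\mathcal{V}_p$, $\widetilde{A}_p(\sum_i x_i\wedge y_i)=\sum_i A_{x_i}y_i$. A horizontal curve is a (piecewise smooth) curve in $M$ orthogonal to the fibers of $\pi$ at every point; the dual leaf through $p\in M$ is the set of all points of $M$ that can be reached from $p$ by horizontal curves, and the collection of dual leaves is the dual foliation. The submersion $\pi$ is called twisted if the dual foliation consists of a single leaf, i.e. any two points of $M$ can be joined by a horizontal curve. *)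

(* Defs.v *)
(* The real numbers are an arbitrary R : realType of MathComp-Analysis. *)
From HB Require Import structures.
From mathcomp Require Import all_boot all_order all_algebra.
From mathcomp Require Import all_classical all_reals all_analysis.

Set Implicit Arguments.
Unset Strict Implicit.
Unset Printing Implicit Defensive.

Import Order.TTheory GRing.Theory Num.Theory.
Import numFieldNormedType.Exports.

Local Open Scope classical_set_scope.
Local Open Scope ring_scope.

(** * Smooth manifolds *)

Fixpoint Ck (R : realType) (V W : normedModType R) (k : nat) (U : set V)
    (f : V -> W) : Prop :=
  match k with
  | 0 => forall x, U x -> {for x, continuous f}
  | k'.+1 => (forall x, U x -> differentiable f x)
             /\ (forall v, Ck k' U (fun x => 'D_v f x))
  end.

(* Meant for open U in a finite-dimensional V. *)
Definition smooth_on (R : realType) (V W : normedModType R) (U : set V)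
  (f : V -> W) : Prop := forall k, Ck k U f.

(* The atlas is indexed by the points of M: [cmap p], with domain [cdom p] and
   inverse [cinv p] (meaningful on [cmap p @` cdom p] only), is a chart around
   p.  Every smooth structure has an atlas of this form.  The index also makes
   [cmap p] a preferred chart at p; see [tmap] below. *)
HB.mixin Record isManifold (R : realType) (n : nat) M of Topological M := {
  cdom : M -> set M;
  cmap : M -> M -> 'rV[R]_n;
  cinv : M -> 'rV[R]_n -> M;
  cdom_self : forall p, cdom p p;
  cdom_open : forall p, open (cdom p);
  cimg_open : forall p, open (cmap p @` cdom p);
  cmapK : forall p q, cdom p q -> cinv p (cmap p q) = q;
  cmap_continuous : forall p q, cdom p q -> {for q, continuous (cmap p)};
  cinv_continuous : forall p x, (cmap p @` cdom p) x ->
    {for x, continuous (cinv p)};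
  transition_smooth : forall p q,
    smooth_on [set x | (cmap p @` cdom p) x /\ cdom q (cinv p x)]
      (fun x => cmap q (cinv p x));
  manifold_hausdorff : hausdorff_space M;
  manifold_second_countable : @second_countable M
}.

#[short(type="manifoldType")]
HB.structure Definition Manifold (R : realType) (n : nat) :=
  {M of Topological M & isManifold R n M}.

Definition cimg (R : realType) n (M : manifoldType R n) (p : M)
  : set 'rV[R]_n := cmap p @` cdom p.

Definition smooth_map (R : realType) n m (M : manifoldType R n)
    (N : manifoldType R m) (A : set M) (f : M -> N) : Prop :=
  (forall p, A p -> {for p, continuous f})
  /\ forall (p : M) (q : N),
       smooth_on [set x | [/\ cimg p x, A (cinv p x) & cdom q (f (cinv p x))]]
         (fun x => cmap q (f (cinv p x))).

(* Smoothness of the map (x, y) |-> f x y on A `*` B, in product charts. *)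
Definition smooth_map2 (R : realType) n m l (M : manifoldType R n)
    (N : manifoldType R m) (P : manifoldType R l) (A : set M) (B : set N)
    (f : M -> N -> P) : Prop :=
  (forall z : M * N, A z.1 -> B z.2 ->
     {for z, continuous (fun z => f z.1 z.2)})
  /\ forall (p : M) (q : N) (r : P),
       smooth_on
         [set z : 'rV[R]_n * 'rV[R]_m |
            [/\ cimg p z.1 /\ cimg q z.2, A (cinv p z.1), B (cinv q z.2)
              & cdom r (f (cinv p z.1) (cinv q z.2))]]
         (fun z => cmap r (f (cinv p z.1) (cinv q z.2))).

(* The tangent space at p is 'rV[R]_n: a tangent vector is given by its
   coordinates in the preferred chart [cmap p].  Accordingly a vector field is
   a function X : M -> 'rV[R]_n, with X q read in the chart [cmap q]. *)
Definition tmap (R : realType) n m (M : manifoldType R n)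
    (N : manifoldType R m) (f : M -> N) (p : M) : 'rV[R]_n -> 'rV[R]_m :=
  'd (fun x => cmap (f p) (f (cinv p x))) (cmap p p).

(* The vector field X in the coordinates of the chart [cmap p]. *)
Definition field_in (R : realType) n (M : manifoldType R n) (p : M)
    (X : M -> 'rV[R]_n) (x : 'rV[R]_n) : 'rV[R]_n :=
  let q := cinv p x in
  'd (fun y => cmap p (cinv q y)) (cmap q q) (X q).

Definition smooth_field (R : realType) n (M : manifoldType R n) (A : set M)
    (X : M -> 'rV[R]_n) : Prop :=
  forall p : M, smooth_on [set x | cimg p x /\ A (cinv p x)] (field_in p X).

Definition lie_bracket (R : realType) n (M : manifoldType R n)
    (X Y : M -> 'rV[R]_n) (p : M) : 'rV[R]_n :=
  let x := cmap p p in
  'D_(field_in p X x) (field_in p Y) x - 'D_(field_in p Y x) (field_in p X) x.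

Definition smooth_curve (R : realType) n (M : manifoldType R n) (I : set R)
    (c : R -> M) : Prop :=
  (forall t, I t -> {for t, continuous c})
  /\ forall p : M,
       smooth_on ([set t | I t /\ cdom p (c t)] : set R^o)
         (fun t : R^o => cmap p (c t)).

Definition velocity (R : realType) n (M : manifoldType R n) (c : R -> M)
    (t : R) : 'rV[R]_n :=
  derive1 (fun s => cmap (c t) (c s)) t.

(** * Riemannian metrics *)

Definition bilin (R : realType) n (A : 'M[R]_n) (u v : 'rV[R]_n) : R :=
  (u *m A *m v^T) 0 0.

(* Coefficients, in the chart [cmap p], of the field of bilinear forms with
   matrix [a q] on the tangent space at q. *)
Definition form_in (R : realType) n (M : manifoldType R n) (a : M -> 'M[R]_n)
    (p : M) (x : 'rV[R]_n) : 'M[R]_n :=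
  let q := cinv p x in
  let J := jacobian (fun y => cmap q (cinv p y)) x in
  J *m a q *m J^T.

Record riemannian (R : realType) n (M : manifoldType R n) := Riemannian {
  gram :> M -> 'M[R]_n;
  gram_sym : forall p, (gram p)^T = gram p;
  gram_posdef : forall p u, u != 0 -> 0 < bilin (gram p) u u;
  gram_smooth : forall p, smooth_on (cimg p) (form_in gram p)
}.

Definition inner (R : realType) n (M : manifoldType R n) (g : riemannian M)
  (p : M) (u v : 'rV[R]_n) : R := bilin (g p) u v.

(* In the chart [cmap p] at x: the covariant derivative, in the direction u, of
   the field with constant coordinates v, for the Levi-Civita connection. *)
Definition christoffel (R : realType) n (M : manifoldType R n)
    (g : riemannian M) (p : M) (x u v : 'rV[R]_n) : 'rV[R]_n :=
  let G := form_in g p in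
  (2^-1 *: \row_l
     (let e : 'rV[R]_n := delta_mx 0 l in
      'D_u (fun y => bilin (G y) v e : R^o) x
      + 'D_v (fun y => bilin (G y) u e : R^o) x
      - 'D_e (fun y => bilin (G y) u v : R^o) x)) *m invmx (G x).

(* R(u, v) w, with R(X, Y) = [nabla_X, nabla_Y] - nabla_[X, Y]. *)
Definition curvature (R : realType) n (M : manifoldType R n)
    (g : riemannian M) (p : M) (u v w : 'rV[R]_n) : 'rV[R]_n :=
  let x := cmap p p in
  let Gam := christoffel g p in
  'D_u (fun y => Gam y v w) x - 'D_v (fun y => Gam y u w) x
  + Gam x u (Gam x v w) - Gam x v (Gam x u w).

Definition sectional (R : realType) n (M : manifoldType R n)
    (g : riemannian M) (p : M) (u v : 'rV[R]_n) : R :=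
  inner g p (curvature g p u v v) u
  / (inner g p u u * inner g p v v - inner g p u v ^+ 2).

Definition nonneg_sectional (R : realType) n (M : manifoldType R n)
    (g : riemannian M) : Prop :=
  forall p u v, free [:: u; v] -> 0 <= sectional g p u v.

Definition geodesic (R : realType) n (M : manifoldType R n)
    (g : riemannian M) (c : R -> M) : Prop :=
  smooth_curve setT c
  /\ forall t,
       let x := fun s => cmap (c t) (c s) in
       derive1n 2 x t + christoffel g (c t) (x t) (derive1 x t) (derive1 x t) = 0.

(* Geodesic completeness. *)
Definition complete_metric (R : realType) n (M : manifoldType R n)
    (g : riemannian M) : Prop :=
  forall p u, exists c, [/\ geodesic g c, c 0 = p & velocity c 0 = u].

(** * Principal bundles *)

HB.mixin Record isLieGroup (R : realType) (n : nat) G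
    of Manifold R n G & Group G := {
  mulg_smooth : smooth_map2 [set: G] [set: G] (fun x y : G => (x * y)%g);
  invg_smooth : smooth_map [set: G] (fun x : G => (x^-1)%g)
}.

#[short(type="lieGroupType")]
HB.structure Definition LieGroup (R : realType) (n : nat) :=
  {G of Manifold R n G & Group G & isLieGroup R n G}.

(* m |-> (proj m, h m) is an equivariant diffeomorphism from proj @^-1` U onto
   U `*` G, with inverse (b, a) |-> s b a. *)
Record local_trivialization (R : realType) n b k (M : manifoldType R n)
    (B : manifoldType R b) (G : lieGroupType R k) (act : M -> G -> M)
    (proj : M -> B) (U : set B) (h : M -> G) (s : B -> G -> M) : Prop := {
  lt_smooth : smooth_map (proj @^-1` U) h;
  lt_inv_smooth : smooth_map2 U [set: G] s;
  lt_invK : forall m, U (proj m) -> s (proj m) (h m) = m;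
  lt_proj : forall x a, U x -> proj (s x a) = x;
  lt_K : forall x a, U x -> h (s x a) = a;
  lt_equivariant : forall m a, U (proj m) -> h (act m a) = (h m * a)%g
}.

Record principal_bundle (R : realType) n b k (M : manifoldType R n)
    (B : manifoldType R b) (G : lieGroupType R k) (act : M -> G -> M)
    (proj : M -> B) : Prop := {
  pb_smooth : smooth_map [set: M] proj;
  pb_act_smooth : smooth_map2 [set: M] [set: G] act;
  pb_act1 : forall m, act m 1%g = m;
  pb_actM : forall m a a', act m (a * a')%g = act (act m a) a';
  pb_act_fiber : forall m a, proj (act m a) = proj m;
  pb_trivial : forall x, exists U h s,
    open_nbhs x U /\ local_trivialization act proj U h s
}.

Definition invariant_metric (R : realType) n k (M : manifoldType R n)
    (G : lieGroupType R k) (act : M -> G -> M) (g : riemannian M) : Prop :=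
  forall a p u v,
    inner g (act p a) (tmap (act^~ a) p u) (tmap (act^~ a) p v)
    = inner g p u v.

(** * Riemannian submersions *)

Definition vertical (R : realType) n b (M : manifoldType R n)
  (B : manifoldType R b) (proj : M -> B) (p : M) : set 'rV[R]_n :=
  [set v | tmap proj p v = 0].

Definition horizontal (R : realType) n b (M : manifoldType R n)
  (B : manifoldType R b) (g : riemannian M) (proj : M -> B) (p : M)
  : set 'rV[R]_n :=
  [set u | forall v, vertical proj p v -> inner g p u v = 0].

Record riemannian_submersion (R : realType) n b (M : manifoldType R n)
    (B : manifoldType R b) (gM : riemannian M) (gB : riemannian B)
    (proj : M -> B) : Prop := {
  rs_smooth : smooth_map [set: M] proj;
  rs_surj : forall x, exists p, proj p = x;
  rs_submersion : forall p w, exists u, tmap proj p u = w;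
  rs_isometry : forall p u v,
    horizontal gM proj p u -> horizontal gM proj p v ->
    inner gB (proj p) (tmap proj p u) (tmap proj p v) = inner gM p u v
}.

Definition vertical_part (R : realType) n b (M : manifoldType R n)
    (B : manifoldType R b) (g : riemannian M) (proj : M -> B) (p : M)
    (z : 'rV[R]_n) : 'rV[R]_n :=
  xget 0 [set v | vertical proj p v /\ horizontal g proj p (z - v)].

Definition horizontal_extension (R : realType) n b (M : manifoldType R n)
    (B : manifoldType R b) (g : riemannian M) (proj : M -> B) (p : M)
    (x : 'rV[R]_n) (X : M -> 'rV[R]_n) : Prop :=
  X p = x
  /\ exists W : set M, [/\ open_nbhs p W, smooth_field W X
       & forall q, W q -> horizontal g proj q (X q)].

(* A_x y for x, y horizontal at p; the value does not depend on the
   extensions, and [xget] picks it out. *)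
Definition oneill (R : realType) n b (M : manifoldType R n)
    (B : manifoldType R b) (g : riemannian M) (proj : M -> B) (p : M)
    (x y : 'rV[R]_n) : 'rV[R]_n :=
  xget 0 [set v | exists X Y,
    [/\ horizontal_extension g proj p x X, horizontal_extension g proj p y Y
      & v = vertical_part g proj p (lie_bracket X Y p)]].

(* The exterior square of a subspace of 'rV[R]_n is realized inside the
   alternating matrices. *)
Definition wedge (R : realType) n (x y : 'rV[R]_n) : 'M[R]_n :=
  x^T *m y - y^T *m x.

Definition horizontal_pairs (R : realType) n b (M : manifoldType R n)
    (B : manifoldType R b) (g : riemannian M) (proj : M -> B) (p : M)
    (s : seq ('rV[R]_n * 'rV[R]_n)) : Prop :=
  forall z, z \in s -> horizontal g proj p z.1 /\ horizontal g proj p z.2.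

Definition horizontal_wedge2 (R : realType) n b (M : manifoldType R n)
    (B : manifoldType R b) (g : riemannian M) (proj : M -> B) (p : M)
    : set 'M[R]_n :=
  [set w | exists s, horizontal_pairs g proj p s
                     /\ w = \sum_(z <- s) wedge z.1 z.2].

(* The linear map sum_i x_i /\ y_i |-> sum_i A_(x_i) y_i; by bilinearity and
   antisymmetry of A the value does not depend on the decomposition. *)
Definition oneill_wedge (R : realType) n b (M : manifoldType R n)
    (B : manifoldType R b) (g : riemannian M) (proj : M -> B) (p : M)
    (w : 'M[R]_n) : 'rV[R]_n :=
  xget 0 [set v | exists s,
    [/\ horizontal_pairs g proj p s, w = \sum_(z <- s) wedge z.1 z.2
      & v = \sum_(z <- s) oneill g proj p z.1 z.2]].

Definition oneill_onto (R : realType) n b (M : manifoldType R n)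
    (B : manifoldType R b) (g : riemannian M) (proj : M -> B) (p : M) : Prop :=
  forall v, vertical proj p v ->
    exists2 w, horizontal_wedge2 g proj p w & oneill_wedge g proj p w = v.

(** * The dual foliation *)

(* On [t0, t1] the curve c is the restriction of a curve that is smooth on an
   open set, with horizontal velocity (one-sided at the endpoints). *)
Definition horizontal_arc (R : realType) n b (M : manifoldType R n)
    (B : manifoldType R b) (g : riemannian M) (proj : M -> B) (c : R -> M)
    (t0 t1 : R) : Prop :=
  exists (I : set R) (d : R -> M),
    [/\ open I, `[t0, t1]%classic `<=` I, smooth_curve I d
      & forall t, t0 <= t <= t1 ->
          c t = d t /\ horizontal g proj (d t) (velocity d t)].

(* Piecewise smooth, with subdivision t0 :: s of [t0, t1]. *)
Definition horizontal_curve (R : realType) n b (M : manifoldType R n)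
    (B : manifoldType R b) (g : riemannian M) (proj : M -> B) (c : R -> M)
    (t0 t1 : R) : Prop :=
  exists s : seq R,
    [/\ path <%R t0 s, last t0 s = t1
      & forall i, (i < size s)%N ->
          horizontal_arc g proj c (nth t0 (t0 :: s) i) (nth t0 s i)].

Definition dual_leaf (R : realType) n b (M : manifoldType R n)
    (B : manifoldType R b) (g : riemannian M) (proj : M -> B) (p : M)
    : set M :=
  [set q | exists t0 t1 c,
     [/\ horizontal_curve g proj c t0 t1, c t0 = p & c t1 = q]].

Definition dual_foliation (R : realType) n b (M : manifoldType R n)
    (B : manifoldType R b) (g : riemannian M) (proj : M -> B) : set (set M) :=
  range (dual_leaf g proj).

Definition twisted (R : realType) n b (M : manifoldType R n)
    (B : manifoldType R b) (g : riemannian M) (proj : M -> B) : Prop :=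
  exists L, dual_foliation g proj = [set L].

(* Main.v *)
(* The horizontal fields and their brackets span the tangent space at p, so by a
   quantitative version of Chow's theorem the dual leaf of p is a neighborhood
   of p: the velocities v that are realized, up to arbitrarily small relative
   error, by moves along the leaf form a linear subspace; it contains X(p) for
   every horizontal field X and, by conjugating flows, every bracket
   [X, Y](p); and when it is everything, the contraction principle shows that
   the leaf covers a neighborhood.  The same principle, applied to a horizontal
   frame, shows that the leaf of any point q projects onto a neighborhood of
   its image in B.  As M is connected, every point is joined by a horizontal
   curve to the fiber of p.  Since G acts by maps preserving horizontal curves,
   the elements a of G with q a in the leaf of q form a neighborhood of 1 for
   every q, which makes all leaves open, and there is only one. *)

(* A commutator of flows has zero velocity at time 0, so no inverse function theorem applies to it
   at the base point. The proof conjugates instead: for a small fixed [s], the flow of one field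
   conjugated by the time [s] map of another is a family in [t] whose velocity contains [s] times
   the bracket, up to an error of smaller order than [s]. Subtracting the field and dividing by [s]
   isolates the bracket, but the error stays positive because [s] does. This is why a realized
   velocity is one that, for every tolerance, is realized by some family depending on that
   tolerance. Errors are measured on differences of two nearby points, as in strict
   differentiability: such bounds add up under composition and have the form that a contraction
   requires. In the initial point, flows accordingly enter only through Lipschitz-type estimates.
   All of this takes place in the preferred chart at the base point, where tangent vectors are row
   vectors already. *)
Require Import Defs.
From HB Require Import structures.
From mathcomp Require Import all_boot all_order all_algebra.
From mathcomp Require Import all_classical all_reals all_analysis.
From mathcomp Require Import ring lra.
Set Implicit Arguments.
Unset Strict Implicit.
Unset Printing Implicit Defensive.
Import Order.TTheory GRing.Theory Num.Theory.
Import numFieldNormedType.Exports.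
Local Open Scope classical_set_scope.
Local Open Scope ring_scope.

(** * Strict differentiability *)

(* Makes matrices a completeNormedModType. *)
HB.instance Definition _ (R : realType) m n := NormedModule.on 'M[R]_(m, n).

Section Norm.
Context {R : realType}.

Lemma ler_coord_mxnorm m n (A : 'M[R]_(m, n)) i j : `|A i j| <= `|A|.
Proof.
by rewrite [leRHS]/Num.Def.normr/= mx_normrE; apply: (le_bigmax _ _ (i, j)).
Qed.

Lemma mxnorm_le m n (A : 'M[R]_(m, n)) C :
  0 <= C -> (forall i j, `|A i j| <= C) -> `|A| <= C.
Proof.
move=> C0 AC; rewrite [leLHS]/Num.Def.normr/= mx_normrE.
by apply: bigmax_le => // -[i j] _; apply: AC.
Qed.

Lemma mulmx_bounded n m (J : 'M[R]_(n, m)) :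
  exists2 K, 1 <= K & forall v : 'rV_n, `|v *m J| <= K * `|v|.
Proof.
(* The summand 1 gives [1 <= K]: the constant serves as a divisor, and multiplying by it must not
   shrink a bound. *)
exists (1 + \sum_i \sum_j `|J i j|).
  by rewrite lerDl; do 2!apply: sumr_ge0 => ? _.
have S0 : 0 <= \sum_i \sum_j `|J i j| by do 2!apply: sumr_ge0 => ? _.
move=> v; apply: mxnorm_le => [|i j]; first by rewrite mulr_ge0// addr_ge0.
rewrite mulrDl mul1r -[leLHS]add0r lerD// mxE.
rewrite (le_trans (ler_norm_sum _ _ _))// mulr_suml ler_sum// => l _.
rewrite normrM mulrC ler_pM// ?ord1 ?ler_coord_mxnorm//.
by rewrite (bigD1 j)//= lerDl sumr_ge0.
Qed.

Lemma is_derive_scalel (V : normedModType R) (v : V) (t : R) :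
  is_derive t 1 (fun s : R => s *: v) v.
Proof.
have dv : is_diff t (fun s : R => s *: v) (fun s : R => s *: v).
  exact: is_diff_scalel.
apply: DeriveDef; first exact: diff_derivable.
by rewrite deriveE// diff_val scale1r.
Qed.

Lemma is_derive_comp_curve (V W : normedModType R) (f : V -> W) (c : R -> V)
    (t : R) (v : V) : is_derive t 1 c v -> differentiable f (c t) ->
  is_derive t 1 (f \o c) ('d f (c t) v).
Proof.
move=> dc df.
have dct : differentiable c t by apply/derivable1_diffP; exact: ex_derive.
have dfct : differentiable (f \o c) t by exact: differentiable_comp.
apply: DeriveDef; first exact: diff_derivable.
rewrite deriveE// diff_comp//=; congr ('d f (c t) _).
by rewrite -(@deriveE _ _ _ _ _ (1 : R^o))// derive_val.
Qed.

(** The norm is the maximum of the coordinates, so the scalar mean value theorem in each coordinate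
    loses no constant. *)
Lemma mean_value_ineq n (c c' : R -> 'rV[R]_n) (a b C : R) : a <= b ->
  (forall t : R, a <= t <= b -> is_derive t 1 c (c' t)) ->
  (forall t : R, a <= t <= b -> `|c' t| <= C) -> `|c b - c a| <= C * (b - a).
Proof.
move=> ab dc c'C.
have C0 : 0 <= C by apply: le_trans (c'C a _); rewrite ?lexx ?ab.
apply: mxnorm_le => [|i j]; first by rewrite mulr_ge0// subr_ge0.
have dcij t : a <= t <= b -> is_derive t 1 (fun s => c s i j) (c' t i j).
  move=> tab; have [dt <-] := dc t tab; apply: DeriveDef.
    exact: (derivable_mxP _ _ _).1.
  by rewrite derive_mx// mxE.
have [||z zab] := @MVT_segment R (fun s => c s i j) (fun s => c' s i j) a b ab.
- by move=> t /[!in_itv]/= /andP[/ltW ? /ltW ?]; apply: dcij; apply/andP.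
- apply: derivable_within_continuous => t /[!in_itv]/= /dcij.
  exact: @ex_derive.
rewrite !mxE => ->; rewrite normrM (ger0_norm (_ : 0 <= b - a)) ?subr_ge0//.
rewrite ler_wpM2r ?subr_ge0// (le_trans (ler_coord_mxnorm _ _ _))// c'C//.
Qed.

End Norm.

Section Strict.
Context {R : realType}.

(** Both points vary, so near [p] the difference of [f] and its linear part has an arbitrarily small
    Lipschitz constant. *)
Definition strict_diff n m (f : 'rV[R]_n -> 'rV[R]_m) (p : 'rV[R]_n)
    (J : 'M[R]_(n, m)) :=
  forall e, 0 < e -> exists2 d, 0 < d & forall x y, `|x - p| < d ->
    `|y - p| < d -> `|f x - f y - (x - y) *m J| <= e * `|x - y|.

Lemma strict_diff_lipschitz n m (f : 'rV[R]_n -> 'rV[R]_m) p J :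
  strict_diff f p J -> exists L d, [/\ 0 < L, 0 < d & forall x y,
    `|x - p| < d -> `|y - p| < d -> `|f x - f y| <= L * `|x - y|].
Proof.
move=> /(_ 1 ltr01)[d d0 fd]; have [K K1 JK] := mulmx_bounded J.
exists (1 + K), d; split => // [|x y xd yd].
  by rewrite addr_gt0// (lt_le_trans ltr01).
rewrite -[f x - f y](subrK ((x - y) *m J)) (le_trans (ler_normD _ _))//.
by rewrite mulrDl lerD// ?fd.
Qed.

Lemma strict_diff_id n (p : 'rV[R]_n) : strict_diff id p 1%:M.
Proof.
move=> e e0; exists 1 => // x y _ _.
by rewrite mulmx1 subrr normr0 mulr_ge0// ltW.
Qed.

Lemma mul_jacobian n m (f : 'rV[R]_n -> 'rV[R]_m) p v :
  differentiable f p ->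
  v *m jacobian f p = \sum_i v 0 i *: 'D_(delta_mx 0 i) f p.
Proof.
move=> df; rewrite {1}[v]row_sum_delta mulmx_suml; apply: eq_bigr => i _.
by rewrite -scalemxAl (deriveEjacobian _ df).
Qed.

(* The continuity of finitely many directional derivatives controls the
   operator norm of the variation of the differential. *)
Lemma C1_strict_diff n m (U : set 'rV[R]_n) (f : 'rV[R]_n -> 'rV[R]_m) p :
  open U -> Ck 1 U f -> U p -> strict_diff f p (jacobian f p).
Proof.
move=> oU [df Df] Up e e0.
(* Each of the [n] coordinates may contribute [e']; the denominator [n.+1] also covers [n = 0]. *)
pose e' := e / n.+1%:R.
have e'0 : 0 < e' by rewrite divr_gt0.
have /nbhs_ballP[d /= d0 dU] : \forall x \near p, U x /\ forall i : 'I_n,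
    `|'D_(delta_mx 0 i) f p - 'D_(delta_mx 0 i) f x| <= e'.
  have near_i i : \forall x \near p,
      `|'D_(delta_mx 0 i) f p - 'D_(delta_mx 0 i) f x| <= e'.
    by have /cvgrPdist_le/(_ _ e'0) := Df (delta_mx 0 i) p Up.
  have Up' : \forall x \near p, U x by exact: open_nbhs_nbhs.
  exact: (filterI Up' (filter_forall _ near_i)).
rewrite -ball_normE/= in dU.
exists d => // x y xd yd.
pose c (t : R) := y + t *: (x - y).
have cd t : 0 <= t <= 1 -> U (c t) /\ forall i : 'I_n,
    `|'D_(delta_mx 0 i) f p - 'D_(delta_mx 0 i) f (c t)| <= e'.
  move=> /andP[t0 t1]; apply: dU => /=; rewrite distrC.
  have -> : c t - p = t *: (x - p) + (1 - t) *: (y - p).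
    by rewrite /c; apply/rowP => j; rewrite !mxE; ring.
  rewrite (le_lt_trans (ler_normD _ _))// !normrZ ger0_norm//.
  rewrite ger0_norm ?subr_ge0//.
  apply: (@le_lt_trans _ _ (Num.max `|x - p| `|y - p|)); last first.
    by rewrite gt_max xd.
  have : `|x - p| <= Num.max `|x - p| `|y - p| by rewrite le_max lexx.
  have : `|y - p| <= Num.max `|x - p| `|y - p| by rewrite le_max lexx orbT.
  nra.
pose g t := f (c t) - t *: ((x - y) *m jacobian f p).
pose g' t := (x - y) *m jacobian f (c t) - (x - y) *m jacobian f p.
have -> : f x - f y - (x - y) *m jacobian f p = g 1 - g 0.
  have -> : g 1 = f x - (x - y) *m jacobian f p.
    by rewrite /g /c !scale1r addrCA subrr addr0.
  by rewrite /g /c !scale0r addr0 subr0 addrAC.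
rewrite -[X in _ <= X]mulr1 -{2}(subr0 1).
apply: (@mean_value_ineq _ _ g g'); first exact: ler01.
- move=> t /cd[Uct _]; rewrite /g'.
  have dfc := df _ Uct.
  have dc : is_derive t 1 c (x - y).
    apply: is_derive_eq; first by apply: is_deriveD; exact: is_derive_scalel.
    by rewrite add0r.
  have dfct : is_derive t 1 (f \o c) ((x - y) *m jacobian f (c t)).
    rewrite -(deriveEjacobian _ dfc) (deriveE _ dfc).
    exact: (is_derive_comp_curve dc dfc).
  have := is_deriveB dfct (is_derive_scalel ((x - y) *m jacobian f p) t).
  exact.
- move=> t /cd[Uct Dct]; rewrite /g'.
  move: (c t) Uct Dct => z Uz Dz.
  have -> : (x - y) *m jacobian f z - (x - y) *m jacobian f p =
      \sum_i (x - y) 0 i *: ('D_(delta_mx 0 i) f z - 'D_(delta_mx 0 i) f p).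
    under eq_bigr do rewrite scalerBr.
    rewrite sumrB; congr (_ - _); apply: mul_jacobian; exact: df.
  apply: le_trans (ler_norm_sum _ _ _) _.
  apply: (@le_trans _ _ (\sum_(i < n) `|x - y| * e')).
    apply: ler_sum => i _; rewrite normrZ ler_pM//.
      exact: ler_coord_mxnorm.
    by rewrite distrC Dz.
  rewrite sumr_const card_ord -mulr_natr -mulrA mulrC ler_wpM2r// /e' -mulrA.
  by rewrite ler_piMr ?(ltW e0)// ler_pdivrMl// mulr1 ler_nat.
Qed.

End Strict.

(** * Flows of Lipschitz vector fields *)

Section Picard.
Context {R : realType}.

(** Used to pass to limits: an inequality is proved for the [k]-th iterate with a geometric error,
    which is then discarded. *)
Lemma le_addhalf_lim (a b E : R) :
  (forall k : nat, a <= b + E * 2^-1 ^+ k) -> a <= b.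
Proof.
move=> abE; apply/ler_addgt0Pr => e e0.
have E0 : E * 2^-1 ^+ k @[k --> \oo] --> (0 : R).
  by apply: cvg_geometric; rewrite ger0_norm// invf_lt1// ltr1n.
have /cvgrPdist_le/(_ _ e0)[N _ /(_ N (leqnn N))] := E0.
rewrite /= sub0r normrN => /ler_normlW Ee.
by rewrite (le_trans (abE N))// lerD2l.
Qed.

Lemma geometric_cvg (V : completeNormedModType R) (u : nat -> V) (C : R) :
  (forall k, `|u k.+1 - u k| <= C * 2^-1 ^+ k) ->
  exists l, forall k, `|u k - l| <= 2 * C * 2^-1 ^+ k.
Proof.
move=> uC.
have C0 : 0 <= C by have := uC 0%N; rewrite expr0 mulr1; exact: le_trans.
have h0 k : (0 : R) <= 2^-1 ^+ k by rewrite exprn_ge0.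
have u_le n m : `|u (n + m)%N - u n| <= 2 * C * 2^-1 ^+ n.
  (* The exact partial sum of the geometric series is what the induction on [m] can carry. *)
  suff : `|u (n + m)%N - u n| <=
      2 * C * 2^-1 ^+ n - 2 * C * 2^-1 ^+ (n + m)%N.
    by move/le_trans; apply; rewrite gerBl ?mulr_ge0.
  elim: m => [|m IH]; first by rewrite addn0 !subrr normr0.
  rewrite -[u _ - u n](subrKA (u (n + m)%N)) (le_trans (ler_normD _ _))//.
  have := uC (n + m)%N; rewrite addnS exprS => H.
  have := lerD H IH; move/le_trans; apply.
  by rewrite le_eqVlt; apply/orP; left; apply/eqP; field.
have : cvgn u.
  apply/cauchy_cvgP/cauchy_exP => e e0.
  have E0 : 2 * C * 2^-1 ^+ k @[k --> \oo] --> (0 : R).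
    by apply: cvg_geometric; rewrite ger0_norm// invf_lt1// ltr1n.
  have /cvgrPdist_lt/(_ _ e0)[N _ /(_ N (leqnn N))] := E0.
  rewrite /= sub0r normrN => /ltr_normlW Ee.
  exists (u N); exists N => // m /= Nm; rewrite -ball_normE/= distrC.
  by rewrite -(subnKC Nm) (le_lt_trans (u_le _ _)).
move=> /cvg_ex[l ul]; exists l => k.
apply/ler_addgt0Pr => e e0.
have /cvgrPdist_le/(_ _ e0)[N _ /(_ (k + N)%N (leq_addl _ _)) ue] := ul.
rewrite -(subrKA (u (k + N)%N)) (le_trans (ler_normD _ _))// lerD//.
  by rewrite distrC u_le.
by rewrite distrC.
Qed.

Lemma primitive_exists (g : R -> R) (a : R) : 0 < a -> continuous g ->
  exists G : R -> R, [/\ continuous G, G 0 = 0 &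
    forall t : R, `|t| < a -> is_derive t 1 G (g t)].
Proof.
move=> a0 cg.
(* Integrating from [- (2 * a)] keeps [[- a, a]] in the interior, where the fundamental theorem
   gives two-sided derivatives. *)
pose F (x : R) := (\int[@lebesgue_measure R]_(t in [set` `[(- (2 * a)), x]])
  g t)%R.
have dF t : - (2 * a) < t < 2 * a -> derivable F t 1 /\ derive1 F t = g t.
  move=> /andP[t1 t2].
  apply: (@continuous_FTC1_closed R g (- (2 * a)) t (2 * a)) => //.
  - apply: continuous_compact_integrable; first exact: segment_compact.
    exact: continuous_subspaceT.
  - exact: cg.
(* Clamping the argument makes the primitive continuous on the whole line, so that it can be fed
   back into the Picard iteration. *)
pose cl (t : R) := Num.max (- a) (Num.min a t).
have cla t : - a <= cl t <= a.
  by rewrite /cl le_max lexx/= ge_max ge_min lexx/= andbT; lra.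
have clid t : `|t| < a -> cl t = t.
  move=> /ltr_normlP[ta1 ta2]; rewrite /cl min_r ?max_r//; lra.
exists (fun t => F (cl t) - F 0); split.
- move=> t; apply: cvgB; last exact: cvg_cst.
  apply: (@continuous_comp _ _ _ cl F).
    apply: continuous_max; first exact: cvg_cst.
    by apply: continuous_min; [exact: cvg_cst|exact: cvg_id].
  have [|+ _] := dF (cl t).
    by have := cla t; move=> /andP[? ?]; apply/andP; split; lra.
  by move/derivable1_diffP/differentiable_continuous.
- by rewrite clid ?normr0// subrr.
- move=> t ta.
  have [|dt Ft] := dF t.
    by move: ta => /ltr_normlP[? ?]; apply/andP; split; lra.
  have H : is_derive t 1 (fun t => F t - F 0) (g t).
    apply: is_derive_eq; first by apply: is_deriveB; exact: derivableP.
    by rewrite subr0 -derive1E.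
  apply: (@near_eq_is_derive _ _ _ (fun t => F t - F 0)) => //.
  have : \forall z \near t, `|z| < a.
    apply: (@open_nbhs_nbhs _ t [set z : R | `|z| < a]); split => //.
    rewrite (_ : [set _ | _] = Num.norm @^-1` [set y | y < a])//.
    by apply: open_comp => [x _|]; [exact: norm_continuous|exact: open_lt].
  by apply: filterS => z za; rewrite clid.
Qed.

Lemma primitive_rV_exists n (g : R -> 'rV[R]_n) (a : R) :
  0 < a -> continuous g ->
  exists G : R -> 'rV[R]_n, [/\ continuous G, G 0 = 0 &
    forall t : R, `|t| < a -> is_derive t 1 G (g t)].
Proof.
move=> a0 cg.
have cgj j : continuous (fun t => g t 0 j).
  move=> t; apply: (@continuous_comp _ _ _ g (fun v : 'rV[R]_n => v 0 j)).
    exact: cg.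
  exact: coord_continuous.
pose Gj j := sval (cid (primitive_exists a0 (cgj j))).
have GjP j : [/\ continuous (Gj j), Gj j 0 = 0 &
    forall t : R, `|t| < a -> is_derive t 1 (Gj j) (g t 0 j)].
  by rewrite /Gj; case: cid.
exists (fun t => \row_j Gj j t); split.
- move=> t; apply/cvgrPdist_lt => e e0.
  have e20 : 0 < e / 2 by rewrite divr_gt0.
  have nearj j : \forall z \near t, `|Gj j t - Gj j z| < e / 2.
    by have [/(_ t) /cvgrPdist_lt/(_ _ e20)] := GjP j.
  near=> z.
  have Hz j : `|Gj j t - Gj j z| < e / 2.
    by move: j; near: z; exact: filter_forall.
  apply: (@le_lt_trans _ _ (e / 2)); last first.
    by rewrite ltr_pdivrMr// ltr_pMr// ltr1n.
  apply: mxnorm_le => [|i j]; first by rewrite ltW// divr_gt0.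
  by rewrite !mxE ltW.
- by apply/rowP => j; rewrite !mxE; have [_ ->] := GjP j.
- move=> t ta.
  have dG : derivable (fun t => \row_j Gj j t) t 1.
    apply/derivable_mxP => i j.
    have [_ _ /(_ t ta)[+ _]] := GjP j.
    by congr (derivable _ t 1); apply/funext => s; rewrite mxE.
  apply: DeriveDef => //; rewrite derive_mx//; apply/rowP => j; rewrite !mxE.
  have [_ _ /(_ t ta)[_ <-]] := GjP j.
  by congr ('D_1 _ t); apply/funext => s; rewrite mxE.
Unshelve. all: by end_near. Qed.

End Picard.

Section Ode.
Context {R : realType} {n : nat}.
Local Notation V := 'rV[R]_n.

Lemma mean_value_seg (c c' : R -> V) (s t C : R) :
  (forall u : R, Num.min s t <= u <= Num.max s t -> is_derive u 1 c (c' u)) ->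
  (forall u : R, Num.min s t <= u <= Num.max s t -> `|c' u| <= C) ->
  `|c t - c s| <= C * `|t - s|.
Proof.
have [st|ts] := leP s t => dc c'C.
  by rewrite ger0_norm ?subr_ge0//; exact: (mean_value_ineq st dc c'C).
rewrite distrC ltr0_norm ?subr_lt0// opprB.
exact: (mean_value_ineq (ltW ts) dc c'C).
Qed.

Lemma itv_min_max_norm (s t r u : R) : `|s| < r -> `|t| < r ->
  Num.min s t <= u <= Num.max s t -> `|u| < r.
Proof.
move=> /ltr_normlP[s1 s2] /ltr_normlP[t1 t2].
rewrite ge_min le_max => /andP[/orP u1 /orP u2]; apply/ltr_normlP.
by split; move: u1 u2 => [?|?] [?|?]; lra.
Qed.

Lemma mean_value_ball (c c' : R -> V) (r C : R) :
  (forall u : R, `|u| < r -> is_derive u 1 c (c' u)) ->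
  (forall u, `|u| < r -> `|c' u| <= C) ->
  forall s t, `|s| < r -> `|t| < r -> `|c t - c s| <= C * `|t - s|.
Proof.
move=> dc c'C s t sr tr; apply: mean_value_seg => u /(itv_min_max_norm sr tr).
  exact: dc.
exact: c'C.
Qed.

(** A quadratic bound passes to limits; this is how the limit of the Picard iterates is shown to be
    differentiable. *)
Lemma is_derive_quad (c : R -> V) (s : R) (v : V) (K r : R) : 0 < r ->
  (forall t, `|t - s| < r ->
    `|c t - c s - (t - s) *: v| <= K * `|t - s| ^+ 2) ->
  is_derive s 1 c v.
Proof.
move=> r0 cK.
have H : (fun h : R => h^-1 *: ((c \o shift s) (h *: (1 : R)) - c s)) @ 0^'
    --> v.
  apply/cvgrPdist_le => e e0; near=> h.
  have h0 : h != 0 by near: h; exact: nbhs_dnbhs_neq.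
  have hr : `|h| < r by near: h; apply: dnbhs0_lt.
  have he : `|h| <= e / (`|K| + 1).
    by near: h; apply: dnbhs0_le; rewrite divr_gt0// ltr_wpDl.
  rewrite distrC /= [h *: 1]mulr1.
  have -> : h^-1 *: (c (h + s) - c s) - v =
      h^-1 *: (c (h + s) - c s - (h + s - s) *: v).
    by rewrite addrK [RHS]scalerBr scalerA mulVf// scale1r.
  rewrite normrZ normfV ler_pdivrMl ?normr_gt0//.
  have := cK (h + s); rewrite addrK => /(_ hr)/le_trans; apply.
  rewrite expr2 mulrCA ler_wpM2l//.
  apply: (@le_trans _ _ ((`|K| + 1) * `|h|)).
    by rewrite ler_wpM2r// (le_trans (ler_norm _))// lerDl.
  by rewrite -ler_pdivlMl ?ltr_wpDl// mulrC.
apply: DeriveDef; first by apply/cvg_ex; exists v.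
exact: cvg_lim H.
Unshelve. all: by end_near. Qed.

Variables (f : V -> V) (L M : R).
Hypotheses (L0 : 0 < L) (M0 : 0 <= M).
Hypothesis f_lip : forall x y, `|f x - f y| <= L * `|x - y|.
Hypothesis f_bnd : forall x, `|f x| <= M.

Lemma lipschitz_cont : continuous f.
Proof.
move=> x; apply/(@cvgrPdist_le _ _ _ (nbhs x)) => e e0; apply/nbhs_ballP.
exists (e / L) => [|y]; first by rewrite /= divr_gt0.
rewrite -ball_normE/= => xy; rewrite (le_trans (f_lip _ _))//.
by rewrite -ler_pdivlMl// mulrC ltW.
Qed.

(** The bound on [L * r] makes each Picard step halve the distance of successive iterates on
    [|t| < r]. *)
Lemma picard (r : R) : 0 < r -> L * r <= 2^-1 -> forall x, exists c : R -> V,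
  c 0 = x /\ forall t : R, `|t| < r -> is_derive t 1 c (f (c t)).
Proof.
move=> r0 Lr x.
pose prim (g : R -> V) : R -> V := xget 0 [set G | [/\ continuous G, G 0 = 0 &
    forall t : R, `|t| < r -> is_derive t 1 G (g t)]].
have primP g : continuous g -> [/\ continuous (prim g), prim g 0 = 0 &
    forall t : R, `|t| < r -> is_derive t 1 (prim g) (g t)].
  by move=> cg; have := xgetPex 0 (primitive_rV_exists r0 cg).
pose step (c : R -> V) t := x + prim (f \o c) t.
pose c_ k := iter k step (cst x).
have c_cont k : continuous (c_ k).
  elim: k => [|k IH]; first by move=> t; exact: cvg_cst.
  move=> t; apply: cvgD; first exact: cvg_cst.
  have [|+ _ _] := primP (f \o c_ k); last exact.
  by move=> s; apply: continuous_comp; [exact: IH|exact: lipschitz_cont].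
have c_0 k : c_ k 0 = x.
  case: k => [//|k]; rewrite /c_ iterS /step.
  have [|_ -> _] := primP (f \o c_ k); last by rewrite addr0.
  by move=> s; apply: continuous_comp; [exact: c_cont|exact: lipschitz_cont].
have c_der k (t : R) : `|t| < r -> is_derive t 1 (c_ k.+1) (f (c_ k t)).
  move=> tr.
  have [|_ _ /(_ t tr) H] := primP (f \o c_ k).
    by move=> s; apply: continuous_comp; [exact: c_cont|exact: lipschitz_cont].
  have Hc : is_derive t 1 (cst x : R -> V) 0 by exact: is_derive_cst.
  by have := is_deriveD Hc H; rewrite add0r.
have z_r : `|0 : R| < r by rewrite normr0.
have c_lip k s t : `|s| < r -> `|t| < r -> `|c_ k t - c_ k s| <= M * `|t - s|.
  case: k => [|k]; first by rewrite subrr normr0 mulr_ge0.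
  by apply: (mean_value_ball (c_der k)) => u _; exact: f_bnd.
have c_step k t : `|t| < r -> `|c_ k.+1 t - c_ k t| <= M * r * 2^-1 ^+ k.
  elim: k t => [|k IH] t tr.
    rewrite expr0 mulr1 -[c_ 0%N t]/x -(c_0 1%N).
    rewrite (le_trans (c_lip 1%N 0 t z_r tr))// subr0 ler_wpM2l// ltW//.
  have dk (u : R) : `|u| < r -> is_derive u 1 (c_ k.+2 - c_ k.+1)
      (f (c_ k.+1 u) - f (c_ k u)).
    by move=> ur; apply: (is_deriveB (c_der _ _ ur) (c_der _ _ ur)).
  have := mean_value_ball dk; rewrite -!/(c_ _ _).
  move=> /(_ (L * (M * r * 2^-1 ^+ k)))/(_ _ 0 t z_r tr).
  rewrite !subr0 -[(c_ k.+2 - c_ k.+1) t]/(c_ k.+2 t - c_ k.+1 t).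
  rewrite -[(c_ k.+2 - c_ k.+1) 0]/(c_ k.+2 0 - c_ k.+1 0) !c_0 subrr subr0.
  have -> : M * r * 2^-1 ^+ k.+1 = 2^-1 * (M * r * 2^-1 ^+ k).
    by rewrite exprS; ring.
  have K0 : 0 <= M * r * 2^-1 ^+ k by rewrite !mulr_ge0// ?exprn_ge0// ltW.
  move=> H; apply: le_trans (H _) _.
    move=> u ur; rewrite (le_trans (f_lip _ _))// ler_wpM2l ?(ltW L0)//.
    exact: IH.
  rewrite mulrAC ler_wpM2r// (le_trans _ Lr)// ler_wpM2l// ltW//.
have c_lim t : exists l, `|t| < r ->
    forall k, `|c_ k t - l| <= 2 * (M * r) * 2^-1 ^+ k.
  have [tr|_] := ltP `|t| r; last by exists 0.
  have [l Hl] :=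
    @geometric_cvg _ V (c_^~ t) (M * r) (fun k => c_step k t tr).
  by exists l.
have [c cP] := choice c_lim.
exists c; split.
  apply/esym/eqP; rewrite -subr_eq0 -normr_le0.
  by apply: le_addhalf_lim => k; rewrite add0r -{1}(c_0 k); exact: cP.
move=> s sr.
(* Along a curve of speed at most [M] the field changes at rate at most [L * M]. *)
apply: (@is_derive_quad _ _ _ (L * M) (r - `|s|)); first by rewrite subr_gt0.
move=> t ts.
have tr : `|t| < r.
  by rewrite -(subrK s t) (le_lt_trans (ler_normD _ _))// -ltrBrDr.
(* [E] collects the geometric errors: the first term compares [c_ k s] with [c s] under [f], the
   second replaces [c_ k.+1] by [c] at [t] and at [s]. *)
pose E := L * (2 * (M * r)) * `|t - s| + 2 * (2 * (M * r)).
apply: (@le_addhalf_lim _ _ _ E) => k.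
have h0 : (0 : R) <= 2^-1 ^+ k by rewrite exprn_ge0.
have A0 : 0 <= 2 * (M * r) * 2^-1 ^+ k.
  by rewrite !mulr_ge0// ltW.
have B : `|c_ k.+1 t - c_ k.+1 s - (t - s) *: f (c s)| <=
    L * (M * `|t - s| + 2 * (M * r) * 2^-1 ^+ k) * `|t - s|.
  have dk (u : R) : Num.min s t <= u <= Num.max s t ->
      is_derive u 1 (c_ k.+1 - (fun t => t *: f (c s)))
      (f (c_ k u) - f (c s)).
    move=> /(itv_min_max_norm sr tr) ur.
    exact: (is_deriveB (c_der _ _ ur) (is_derive_scalel _ u)).
  have := mean_value_seg dk.
  rewrite -![(c_ k.+1 - _) _]/(c_ k.+1 _ - _ *: _) => H.
  have -> : c_ k.+1 t - c_ k.+1 s - (t - s) *: f (c s) =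
      c_ k.+1 t - t *: f (c s) - (c_ k.+1 s - s *: f (c s)).
    by apply/rowP => j; rewrite !mxE; ring.
  apply: H => u ust; have ur := itv_min_max_norm sr tr ust.
  rewrite (le_trans (f_lip _ _))// ler_wpM2l ?(ltW L0)//.
  rewrite -(subrKA (c_ k s)) (le_trans (ler_normD _ _))// lerD ?cP//.
  rewrite (le_trans (c_lip k s u sr ur))// ler_wpM2l//.
  move: ust; have [st|st] := leP s t => /andP[u1 u2].
    by rewrite !ger0_norm ?subr_ge0// lerD2r.
  by rewrite !ler0_norm ?subr_le0// ?(ltW st)// !opprB lerD2l lerN2.
have -> : c t - c s - (t - s) *: f (c s) =
    (c_ k.+1 t - c_ k.+1 s - (t - s) *: f (c s)) -
    ((c_ k.+1 t - c t) - (c_ k.+1 s - c s)).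
  by apply/rowP => j; rewrite !mxE; ring.
rewrite (le_trans (ler_normB _ _))//.
have := cP t tr k.+1; have := cP s sr k.+1.
have := ler_normB (c_ k.+1 t - c t) (c_ k.+1 s - c s).
rewrite /E exprS expr2; move: B.
set a := `|_ - _ - _ *: _|; set b := `|_ - _ - (_ - _)|.
set d := `|c_ _ t - _|; set d' := `|c_ _ s - _|; set ee := `|t - s|.
have Mh : 0 <= M * r * 2^-1 ^+ k by rewrite !mulr_ge0// ltW.
set h := 2^-1 ^+ k in h0 Mh *; move: Mh; set Mr := M * r.
clearbody a b d d' ee h Mr; move=> *; nra.
Qed.

End Ode.

(** * Dependence of solutions on the initial point *)

Section Comparison.
Context {R : realType} {n : nat}.
Local Notation V := 'rV[R]_n.
Variables (f : V -> V) (L M r : R) (y z : R -> V).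
Hypotheses (L0 : 0 < L) (M0 : 0 <= M) (r0 : 0 < r) (Lr : L * r <= 2^-1).
Hypothesis f_lip : forall x x', `|f x - f x'| <= L * `|x - x'|.
Hypothesis f_bnd : forall x, `|f x| <= M.
Hypothesis dy : forall t : R, `|t| < r -> is_derive t 1 y (f (y t)).
Hypothesis dz : forall t : R, `|t| < r -> is_derive t 1 z (f (z t)).

Let zero_r : `|0 : R| < r. Proof. by rewrite normr0. Qed.

Let drift (C : R) : (forall t : R, `|t| < r -> `|y t - z t| <= C) ->
  forall t : R, `|t| < r -> `|y t - z t - (y 0 - z 0)| <= L * C * `|t|.
Proof.
move=> HC t tr.
have dyz (u : R) : `|u| < r -> is_derive u 1 (y - z) (f (y u) - f (z u)).
  by move=> ur; apply: (is_deriveB (dy ur) (dz ur)).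
have := mean_value_ball dyz.
rewrite -!/((y - z) _) => /(_ (L * C))/(_ _ 0 t zero_r tr); rewrite subr0.
apply=> u ur; rewrite (le_trans (f_lip _ _))// ler_wpM2l ?(ltW L0)//.
exact: HC.
Qed.

(** A bootstrap: any bound [C] on the difference improves to [|y 0 - z 0| + C / 2], and iterating
    this tends to [2 * |y 0 - z 0|]. The speed bound [M] provides the first [C]. *)
Lemma solution_lipschitz (t : R) : `|t| < r -> `|y t - z t| <= 2 * `|y 0 - z 0|.
Proof.
move=> tr; apply: (@le_addhalf_lim _ _ _ (2 * (M * r))) => k.
elim: k t tr => [|k IH] t tr.
  have := mean_value_ball dy (fun u _ => f_bnd (y u)) zero_r tr.
  have := mean_value_ball dz (fun u _ => f_bnd (z u)) zero_r tr.
  have -> : y t - z t = (y t - y 0) - (z t - z 0) + (y 0 - z 0).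
    by apply/rowP => j; rewrite !mxE; ring.
  have := ler_normD ((y t - y 0) - (z t - z 0)) (y 0 - z 0).
  have := ler_normB (y t - y 0) (z t - z 0).
  have : M * `|t - 0| <= M * r by rewrite subr0 ler_wpM2l// ltW.
  have := normr_ge0 (y 0 - z 0); rewrite expr0 mulr1; lra.
have h0 : (0 : R) <= 2^-1 ^+ k by rewrite exprn_ge0.
have := drift IH tr; set C := _ + _ * 2^-1 ^+ k.
have C0 : 0 <= C by rewrite addr_ge0// !mulr_ge0// ltW.
have : L * C * `|t| <= 2^-1 * C.
  by rewrite mulrAC ler_wpM2r// (le_trans _ Lr)// ler_wpM2l// ltW.
rewrite -[y t - z t](subrK (y 0 - z 0)).
have := ler_normD (y t - z t - (y 0 - z 0)) (y 0 - z 0).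
by rewrite addrK exprS /C; lra.
Qed.

Lemma solution_drift (t : R) : `|t| < r ->
  `|y t - z t - (y 0 - z 0)| <= 2 * L * `|t| * `|y 0 - z 0|.
Proof.
move=> tr; have := drift (fun u => @solution_lipschitz u) tr.
by move=> /le_trans; apply; rewrite le_eqVlt; apply/orP; left; apply/eqP; ring.
Qed.

End Comparison.

(* [phi] is defined everywhere; it is the flow of a globally Lipschitz field
   that coincides with [f] near [p]. *)
Record flow_box (R : realType) n (f : 'rV[R]_n -> 'rV[R]_n) (U : set 'rV[R]_n)
    (p : 'rV[R]_n) (phi : R -> 'rV[R]_n -> 'rV[R]_n) (r L M : R) : Prop := {
  fb_r : 0 < r;
  fb_L : 0 < L;
  fb_M : 0 <= M;
  fb_Lr : L * r <= 2^-1;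
  fb_0 : forall x, phi 0 x = x;
  fb_in : forall x (t : R), `|x - p| < r -> `|t| < r -> U (phi t x);
  fb_der : forall x (t : R), `|x - p| < r -> `|t| < r ->
    is_derive t 1 (phi^~ x) (f (phi t x));
  fb_time : forall x (t t' : R), `|t| < r -> `|t'| < r ->
    `|phi t x - phi t' x| <= M * `|t - t'|;
  fb_drift : forall x x' (t : R), `|t| < r ->
    `|phi t x - phi t x' - (x - x')| <= 2 * L * `|t| * `|x - x'|;
  fb_lip : forall x x' (t t' : R), `|x - p| < r -> `|x' - p| < r ->
    `|t| < r -> `|t'| < r ->
    `|f (phi t x) - f (phi t' x')| <= L * `|phi t x - phi t' x'|;
  fb_inv : forall x (t : R), `|t| < r -> phi t (phi (- t) x) = x
}.

Section Clamp.
Context {R : realType} {n : nat}.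
Variables (p : 'rV[R]_n) (e : R).
Hypothesis e0 : 0 < e.

(** A nonexpansive retraction onto the closed ball of the maximum norm. Precomposing with it turns a
    field that is Lipschitz near [p] into a bounded, globally Lipschitz one. *)
Definition clamp (x : 'rV[R]_n) : 'rV[R]_n :=
  \row_j Num.max (p 0 j - e) (Num.min (p 0 j + e) (x 0 j)).

Lemma clamp_near x : `|clamp x - p| <= e.
Proof.
apply: mxnorm_le => [|i j]; first exact: ltW.
rewrite !mxE ord1 ler_distl le_max lexx/= ge_max ge_min lexx/= andbT.
by move: (p 0 j) e0 => a b; lra.
Qed.

Lemma clamp_id x : `|x - p| <= e -> clamp x = x.
Proof.
move=> xe; apply/rowP => j; rewrite mxE.
have := le_trans (ler_coord_mxnorm (x - p) 0 j) xe.
by rewrite !mxE ler_distl => /andP[? ?]; rewrite min_r// max_r.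
Qed.

Lemma clamp_lip x y : `|clamp x - clamp y| <= `|x - y|.
Proof.
apply: mxnorm_le => // i j; rewrite !mxE.
have := ler_coord_mxnorm (x - y) 0 j; rewrite !mxE; apply: le_trans.
move: (x 0 j) (y 0 j) (p 0 j) => a b c.
have := ler_norm (a - b); have := ler_norm (b - a); rewrite (distrC b a).
move: `|a - b| => m h1 h2; rewrite ler_norml; move: e0.
have [a1|a1] := leP (c + e) a; have [b1|b1] := leP (c + e) b;
  repeat match goal with |- context [Order.max ?x ?y] =>
    have [?|?] := leP x y end; lra.
Qed.

End Clamp.

Section FlowBox.
Context {R : realType} {n : nat}.
Local Notation V := 'rV[R]_n.

Lemma flow_box_exists (f : V -> V) (U : set V) (p : V) J :
  strict_diff f p J -> open U -> U p ->
  exists phi r L M, flow_box f U p phi r L M.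
Proof.
move=> sf oU Up.
have [L [d [L0 d0 fL]]] := strict_diff_lipschitz sf.
have /nbhs_ballP[e /= e0 eU] : nbhs p U by exact: open_nbhs_nbhs.
rewrite -ball_normE in eU.
pose rho := Num.min (e / 2) (d / 2) / 2.
have rho0 : 0 < rho by rewrite divr_gt0// lt_min !divr_gt0//.
have rhoe : rho < e /\ rho < d.
  have : Num.min (e / 2) (d / 2) <= e / 2 by rewrite ge_min lexx.
  have : Num.min (e / 2) (d / 2) <= d / 2 by rewrite ge_min lexx orbT.
  by rewrite /rho; lra.
have rhoU x : `|x - p| <= rho -> U x.
  move=> xp; apply: (eU x) => /=; rewrite distrC (le_lt_trans xp)//.
  by case: rhoe.
pose g x := f (clamp p rho x).
pose M := `|f p| + L * rho.
have M0 : 0 <= M by rewrite addr_ge0// mulr_ge0// ltW.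
have near_d x : `|clamp p rho x - p| < d.
  by rewrite (le_lt_trans (clamp_near _ rho0 _))//; case: rhoe.
have pd : `|p - p| < d by rewrite subrr normr0.
have g_lip x x' : `|g x - g x'| <= L * `|x - x'|.
  rewrite (le_trans (fL _ _ (near_d x) (near_d x')))// ler_wpM2l ?(ltW L0)//.
  exact: clamp_lip.
have g_bnd x : `|g x| <= M.
  rewrite -[g x](subrK (f p)) addrC (le_trans (ler_normD _ _))// lerD2l.
  rewrite (le_trans (fL _ _ (near_d x) pd))// ler_wpM2l ?(ltW L0)//.
  exact: clamp_near.
pose r1 := (2 * L)^-1.
have r10 : 0 < r1 by rewrite invr_gt0 mulr_gt0.
have Lr1 : L * r1 <= 2^-1 by rewrite /r1 invfM mulrCA mulfV ?mulr1// gt_eqF.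
have [phi phiP] := choice (picard L0 M0 g_lip g_bnd r10 Lr1).
have phi0 x : phi x 0 = x by have [] := phiP x.
have dphi x (t : R) : `|t| < r1 -> is_derive t 1 (phi x) (g (phi x t)).
  by have [_] := phiP x; exact.
(* A solution starting within [r] of [p] stays within [r + M * r <= rho], where the clamp is the
   identity. Half of [r1] leaves room for the time shift [s - t] below. *)
pose r := Num.min (r1 / 2) (rho / (M + 1)).
have M1 : 0 < M + 1 by rewrite ltr_wpDl.
have r0 : 0 < r by rewrite lt_min (divr_gt0 r10)//= (divr_gt0 rho0 M1).
have rr1 : r <= r1 / 2 by rewrite ge_min lexx.
have rr1' : r < r1 by lra.
have rrho : r * (M + 1) <= rho by rewrite -ler_pdivlMr// ge_min lexx orbT.
have time x (t t' : R) : `|t| < r1 -> `|t'| < r1 ->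
    `|phi x t - phi x t'| <= M * `|t - t'|.
  move=> tr tr'; apply: (mean_value_ball (dphi x)) => // u _; exact: g_bnd.
have stay x (t : R) : `|x - p| < r -> `|t| < r -> `|phi x t - p| <= rho.
  move=> xr tr; rewrite -(subrKA x) (le_trans (ler_normD _ _))//.
  have := time x t 0 (lt_trans tr rr1'); rewrite phi0 normr0 subr0 => /(_ r10).
  have : M * `|t| <= M * r by rewrite ler_wpM2l// ltW.
  by move: rrho; rewrite mulrDr mulr1 [r * M]mulrC; lra.
exists (fun t x => phi x t), r, L, M; constructor => //.
- by rewrite (le_trans _ Lr1)// ler_wpM2l ?(ltW L0)// ltW.
- by move=> x t xr tr; exact/rhoU/stay.
- move=> x t xr tr; have := dphi x t (lt_trans tr rr1').
  by rewrite /g clamp_id//; exact: stay.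
- by move=> x t t' tr tr'; apply: time; exact: lt_trans rr1'.
- move=> x x' t tr.
  have := solution_drift L0 M0 r10 Lr1 g_lip g_bnd (dphi x) (dphi x').
  by move=> /(_ _ (lt_trans tr rr1')); rewrite !phi0.
- move=> x x' t t' xr xr' tr tr'; apply: fL.
    by rewrite (le_lt_trans (stay _ _ _ _))//; case: rhoe.
  by rewrite (le_lt_trans (stay _ _ _ _))//; case: rhoe.
- move=> x t tr.
  (* The shifted solution and the solution through [phi x (- t)] agree at time 0, hence at time [t]
     by [solution_lipschitz]. *)
  pose y (s : R) := phi x (s - t).
  have dy (s : R) : `|s| < r1 / 2 -> is_derive s 1 y (g (y s)).
    move=> sr.
    have str : `|s - t| < r1.
      by rewrite (le_lt_trans (ler_normB _ _))//; lra.
    have ds : is_derive s 1 (fun u : R => u - t) (1 : R).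
      have := is_deriveB (is_derive_id s (1 : R)) (is_derive_cst t s (1 : R)).
      by rewrite subr0.
    have := dphi x _ str => dx.
    have dfx : differentiable (phi x) (s - t).
      by apply/derivable1_diffP; exact: ex_derive.
    have := is_derive_comp_curve ds dfx.
    by rewrite -(@deriveE _ _ _ _ _ (1 : R^o))// derive_val.
  have Lr2 : L * (r1 / 2) <= 2^-1.
    rewrite (le_trans _ Lr1)// ler_wpM2l ?(ltW L0)//; lra.
  have r20 : 0 < r1 / 2 by rewrite divr_gt0.
  have dz (s : R) : `|s| < r1 / 2 ->
      is_derive s 1 (phi (phi x (- t))) (g (phi (phi x (- t)) s)).
    by move=> sr; apply: dphi; lra.
  have := solution_lipschitz L0 M0 r20 Lr2 g_lip g_bnd dz dy.
  move=> /(_ t (lt_le_trans tr rr1)).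
  rewrite /y sub0r phi0 !subrr phi0 normr0 mulr0 normr_le0 subr_eq0.
  by move=> /eqP.
Qed.

End FlowBox.

Section FlowEstimates.
Context {R : realType} {n : nat}.
Local Notation V := 'rV[R]_n.
Variables (f : V -> V) (U : set V) (p : V) (phi : R -> V -> V) (r L M : R).
Hypothesis box : flow_box f U p phi r L M.

Let r0 := fb_r box.
Let L0 := fb_L box.
Let M0 := fb_M box.
Let zero_r : `|0 : R| < r. Proof. by rewrite normr0. Qed.

Lemma flow_lip2 x x' (t : R) :
  `|t| < r -> `|phi t x - phi t x'| <= 2 * `|x - x'|.
Proof.
move=> tr; have := fb_drift box x x' tr.
have := ler_normD (phi t x - phi t x' - (x - x')) (x - x'); rewrite subrK.
have : L * `|t| <= 2^-1.
  by rewrite (le_trans _ (fb_Lr box))// ler_wpM2l ?(ltW L0)// ltW.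
have := normr_ge0 (x - x'); nra.
Qed.

Lemma flow_time0 x (t : R) : `|t| < r -> `|phi t x - x| <= M * `|t|.
Proof.
by move=> tr; have := fb_time box x tr zero_r; rewrite (fb_0 box) subr0.
Qed.

(** Joint strict differentiability in time and space at [(0, y0)]. The base point may differ from
    [p] because [reach_conjugate] applies this at a displaced point. *)
Lemma flow_strict y0 : `|y0 - p| < r -> forall e, 0 < e ->
  exists2 d, 0 < d & forall y y' (t t' : R),
    `|t| < d -> `|t'| < d -> `|y - y0| < d -> `|y' - y0| < d ->
    `|phi t y - phi t' y' - (y - y') - (t - t') *: f y0| <=
      e * (`|t - t'| + `|y - y'|).
Proof.
move=> y0r e e0.
(* The first summand comes from the change of time, where the orbit stays within [(M + 1) * d] of
   [y0], and the second from the change of initial point, by [fb_drift]. *)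
have C0 : 0 < L * (M + 1) + 2 * L by rewrite addr_gt0// !mulr_gt0// ltr_wpDl.
near (0 : R)^'+ => d.
have d0 : 0 < d by [].
have dr : d < r - `|y0 - p| by near: d; apply: nbhs_right_lt; rewrite subr_gt0.
have de : d <= e / (L * (M + 1) + 2 * L).
  by near: d; apply: nbhs_right_le; rewrite divr_gt0.
rewrite ler_pdivlMr// in de.
exists d => // y y' t t' td t'd yd y'd.
have rd : d < r by have := normr_ge0 (y0 - p); lra.
have inr z : `|z - y0| < d -> `|z - p| < r.
  by move=> zd; rewrite -(subrKA y0) (le_lt_trans (ler_normD _ _))//; lra.
have tr := lt_trans td rd; have t'r := lt_trans t'd rd.
have D := fb_drift box y y' t'r.
have T : `|phi t y - phi t' y - (t - t') *: f y0| <=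
    L * (M + 1) * d * `|t - t'|.
  have dk (u : R) : Num.min t' t <= u <= Num.max t' t ->
      is_derive u 1 (phi^~ y - (fun u => u *: f y0)) (f (phi u y) - f y0).
    move=> /(itv_min_max_norm t'r tr) ur.
    exact: (is_deriveB (fb_der box (inr _ yd) ur) (is_derive_scalel _ u)).
  have -> : phi t y - phi t' y - (t - t') *: f y0 =
      phi t y - t *: f y0 - (phi t' y - t' *: f y0).
    by apply/rowP => j; rewrite !mxE; ring.
  apply: (mean_value_seg dk) => u ut.
  have ud := itv_min_max_norm t'd td ut.
  rewrite -[X in f _ - f X](fb_0 box) (le_trans (fb_lip box _ _ _ _))//.
  - exact: inr.
  - exact: lt_trans rd.
  rewrite (fb_0 box) -mulrA ler_wpM2l ?(ltW L0)//.
  rewrite -(subrKA y) (le_trans (ler_normD _ _))//.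
  rewrite mulrDl mul1r lerD ?(ltW yd)//.
  by rewrite (le_trans (flow_time0 _ (lt_trans ud rd)))// ler_wpM2l// ltW.
have -> : phi t y - phi t' y' - (y - y') - (t - t') *: f y0 =
    phi t y - phi t' y - (t - t') *: f y0 +
    (phi t' y - phi t' y' - (y - y')).
  by apply/rowP => j; rewrite !mxE; ring.
rewrite (le_trans (ler_normD _ _))// mulrDr lerD//.
  rewrite (le_trans T)// ler_wpM2r//.
  by move: de; rewrite mulrDr; have := mulr_gt0 d0 L0; lra.
rewrite (le_trans D)// ler_wpM2r//.
have : L * `|t'| <= L * d by rewrite ler_wpM2l ?(ltW L0)// ltW.
have : 0 <= d * (L * (M + 1)).
  by rewrite !mulr_ge0// ?(ltW L0)// ?addr_ge0// ltW.
by move: de; rewrite mulrDr; lra.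
Unshelve. all: by end_near. Qed.

(** Near [p] the time [s] map is [1 + s J] up to [o(s)], in the strict sense. The factor [|s|] in
    the error is what keeps the bracket visible after the later division by [s]. *)
Lemma flow_linearized J : strict_diff f p J -> forall e, 0 < e ->
  exists2 d, 0 < d & forall x x' (s : R),
    `|s| < d -> `|x - p| < d -> `|x' - p| < d ->
    `|phi s x - phi s x' - (x - x') - s *: ((x - x') *m J)| <=
      e * `|s| * `|x - x'|.
Proof.
move=> sf e e0; have [K K1 JK] := mulmx_bounded J.
have [|d1 d10 fd1] := sf (e / 4); first by rewrite divr_gt0.
have K0 : 0 < K by rewrite (lt_le_trans ltr01).
(* Half of [e] pays for the nonlinearity of [f], as [e / 4] is doubled by [flow_lip2]; the bound on
   [4 * K * L * d] makes the drift cost the other half. *)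
near (0 : R)^'+ => d.
have d0 : 0 < d by [].
have dr : d < r by near: d; apply: nbhs_right_lt.
have de : d <= e / (4 * K * L).
  by near: d; apply: nbhs_right_le; rewrite divr_gt0// !mulr_gt0.
have dM : d <= d1 / (M + 1).
  by near: d; apply: nbhs_right_le; rewrite divr_gt0// ltr_wpDl.
rewrite ler_pdivlMr ?mulr_gt0// in de; rewrite ler_pdivlMr ?ltr_wpDl// in dM.
exists d => // x x' s sd xd x'd.
have sr := lt_trans sd dr.
have dk (u : R) : Num.min 0 s <= u <= Num.max 0 s ->
    is_derive u 1 (phi^~ x - phi^~ x' - (fun u => u *: ((x - x') *m J)))
      (f (phi u x) - f (phi u x') - (x - x') *m J).
  move=> /(itv_min_max_norm zero_r sr) ur.
  have D1 := fb_der box (lt_trans xd dr) ur.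
  have D2 := fb_der box (lt_trans x'd dr) ur.
  exact: (is_deriveB (is_deriveB D1 D2) (is_derive_scalel _ u)).
have -> : phi s x - phi s x' - (x - x') - s *: ((x - x') *m J) =
    phi s x - phi s x' - s *: ((x - x') *m J) -
    (phi 0 x - phi 0 x' - 0 *: ((x - x') *m J)).
  by rewrite !(fb_0 box) scale0r subr0 addrAC.
have -> : e * `|s| * `|x - x'| = e * `|x - x'| * `|s - 0|.
  by rewrite subr0 mulrAC.
apply: (mean_value_seg dk) => u us.
have ud : `|u| < d by apply: itv_min_max_norm us; rewrite ?normr0.
have ur := lt_trans ud dr.
have near1 z : `|z - p| < d -> `|phi u z - p| < d1.
  move=> zd; rewrite -(subrKA z) (le_lt_trans (ler_normD _ _))//.
  have := flow_time0 z ur.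
  have : M * `|u| <= M * d by rewrite ler_wpM2l// ltW.
  by move: dM; rewrite mulrDr; lra.
have -> : f (phi u x) - f (phi u x') - (x - x') *m J =
    f (phi u x) - f (phi u x') - (phi u x - phi u x') *m J +
    (phi u x - phi u x' - (x - x')) *m J.
  by rewrite (mulmxBl (phi u x - phi u x')) addrA subrK.
rewrite (le_trans (ler_normD _ _))//.
have A := fd1 _ _ (near1 _ xd) (near1 _ x'd).
have B := JK (phi u x - phi u x' - (x - x')).
have C := flow_lip2 x x' ur.
have D := fb_drift box x x' ur.
have KD : K * `|phi u x - phi u x' - (x - x')| <=
    K * (2 * L * `|u| * `|x - x'|) by rewrite ler_wpM2l// ltW.
have eC : e / 4 * `|phi u x - phi u x'| <= e / 4 * (2 * `|x - x'|).
  by rewrite ler_wpM2l// ltW// divr_gt0.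
have KLu : 4 * K * L * `|u| * `|x - x'| <= e * `|x - x'|.
  rewrite ler_wpM2r//; apply: le_trans de; rewrite mulrC ler_wpM2r//.
    by rewrite !mulr_ge0// ltW.
  exact: ltW.
by lra.
Unshelve. all: by end_near. Qed.

End FlowEstimates.

(** * Approximate velocities of moves *)

Section Reach.
Context {R : realType} {n : nat}.
Local Notation V := 'rV[R]_n.
Variables (rel : V -> V -> Prop) (p : V).
Hypothesis rel_refl : forall x, rel x x.
Hypothesis rel_trans : forall x y z, rel x y -> rel y z -> rel x z.

(* [A] is, up to the relative error [e], the derivative at [(0, p)] of a family
   of moves [gam t] along [rel], uniformly on pairs of nearby points.  This
   notion survives composition, and error terms below 1 / 2 suffice for the
   open mapping argument of [attain_open]. *)
Definition reach d (A : 'M[R]_(d, n)) (e : R) :=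
  exists gam : 'rV[R]_d -> V -> V, gam 0 p = p /\
  exists2 del, 0 < del & forall t t' q q', `|t| < del -> `|t'| < del ->
    `|q - p| < del -> `|q' - p| < del -> rel q (gam t q) /\
    `|gam t q - gam t' q' - (q - q') - (t - t') *m A| <=
      e * (`|t - t'| + `|q - q'|).

Definition attain d (A : 'M[R]_(d, n)) := forall e, 0 < e -> reach A e.

Lemma reach_le d (A : 'M[R]_(d, n)) e e' : e <= e' -> reach A e -> reach A e'.
Proof.
move=> ee' [gam [gamp [del del0 H]]]; exists gam; split => //; exists del => //.
move=> t t' q q' td t'd qd q'd; have [? B] := H _ _ _ _ td t'd qd q'd.
by split => //; rewrite (le_trans B)// ler_wpM2r// addr_ge0.
Qed.

Lemma reach_lin d d' (A : 'M[R]_(d, n)) (B : 'M[R]_(d', d)) e K :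
  0 <= e -> 1 <= K -> (forall t : 'rV_d', `|t *m B| <= K * `|t|) ->
  reach A e -> reach (B *m A) (e * K).
Proof.
move=> e0 K1 BK [gam [gamp [del del0 H]]].
have K0 : 0 < K by rewrite (lt_le_trans ltr01).
exists (fun t q => gam (t *m B) q); split; first by rewrite mul0mx.
have smaller (t : 'rV_d') : `|t| < del / K -> `|t *m B| < del.
  by rewrite ltr_pdivlMr// mulrC => /(le_lt_trans (BK t)).
have dK : del / K <= del by rewrite ler_pdivrMr// ler_peMr// ltW.
exists (del / K) => [|t t' q q' td t'd qd q'd]; first by rewrite divr_gt0.
have [rq E] := H _ _ _ _ (smaller _ td) (smaller _ t'd)
  (lt_le_trans qd dK) (lt_le_trans q'd dK).
split => //; rewrite mulmxA mulmxBl (le_trans E)// -mulrA ler_wpM2l//.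
rewrite mulrDr lerD//; last by rewrite ler_peMl.
by rewrite -mulmxBl.
Qed.

(** The move for [A'] comes first, so the error of [A] is measured at displaced points. As
    [e' <= 1], these differ by at most [2 + K] times the original difference, parameters
    included. *)
Lemma reach_cat d d' (A : 'M[R]_(d, n)) (A' : 'M[R]_(d', n)) e e' K :
  0 <= e -> 0 <= e' <= 1 -> 1 <= K ->
  (forall t : 'rV_d', `|t *m A'| <= K * `|t|) ->
  reach A e -> reach A' e' -> reach (col_mx A A') (e' + e * (2 + K)).
Proof.
move=> e0 /andP[e'0 e'1] K1 KA' [g [gp [d1 d10 H]]] [g' [g'p [d2 d20 H']]].
exists (fun t q => g (lsubmx t) (g' (rsubmx t) q)).
split; first by rewrite !linear0 g'p.
have lsub_le (t : 'rV[R]_(d + d')) : `|lsubmx t| <= `|t|.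
  by apply: mxnorm_le => // i j; rewrite mxE ler_coord_mxnorm.
have rsub_le (t : 'rV[R]_(d + d')) : `|rsubmx t| <= `|t|.
  by apply: mxnorm_le => // i j; rewrite mxE ler_coord_mxnorm.
have K0 : 0 < K by rewrite (lt_le_trans ltr01).
have K20 : 0 < 2 + 2 * K by rewrite addr_gt0// mulr_gt0.
(* The first move takes points within [del] of [p] to points within [(3 + K) * del], which is at
   most [(2 + 2 * K) * del] since [1 <= K]. *)
pose del := Num.min (d1 / (2 + 2 * K)) d2.
have del1 : del * (2 + 2 * K) <= d1.
  by rewrite -ler_pdivlMr// ge_min lexx.
have del2 : del <= d2 by rewrite ge_min lexx orbT.
have del0 : 0 < del by rewrite lt_min divr_gt0.
have deld1 : del <= d1 by move: del1; rewrite mulrDr; nra.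
exists del => // t t' q q' td t'd qd q'd.
have rt := le_lt_trans (rsub_le t) (lt_le_trans td del2).
have rt' := le_lt_trans (rsub_le t') (lt_le_trans t'd del2).
have lt := le_lt_trans (lsub_le t) (lt_le_trans td deld1).
have lt' := le_lt_trans (lsub_le t') (lt_le_trans t'd deld1).
have close (u : 'rV[R]_(d + d')) x : `|u| < del -> `|x - p| < del ->
    `|g' (rsubmx u) x - p| < d1.
  move=> ud xd.
  have [] := H' (rsubmx u) 0 x p (le_lt_trans (rsub_le u) (lt_le_trans ud del2))
    _ (lt_le_trans xd del2) _; rewrite ?normr0 ?subrr ?normr0//.
  rewrite g'p subr0 => _ E; have Ku := KA' (rsubmx u).
  have -> : g' (rsubmx u) x - p = (x - p) + rsubmx u *m A' +
      (g' (rsubmx u) x - p - (x - p) - rsubmx u *m A').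
    by rewrite addrCA !addrA; apply/rowP => j; rewrite !mxE; ring.
  have := ler_normD (x - p + rsubmx u *m A')
     (g' (rsubmx u) x - p - (x - p) - rsubmx u *m A').
  have := ler_normD (x - p) (rsubmx u *m A').
  have := rsub_le u; move: E Ku ud xd del1.
  set a := `|g' _ _ - _ - _ - _|; set b := `|_ + _|; set c := `|_ + _ + _|.
  set ru := `|rsubmx u|; set rA := `|rsubmx u *m A'|.
  have := normr_ge0 (x - p); have := normr_ge0 (rsubmx u); rewrite -/ru.
  move: `|x - p| `|u| => xp uu; clearbody a b c ru rA; move=> *.
  have : e' * (ru + xp) <= ru + xp by rewrite ler_piMl// addr_ge0.
  have : K * ru <= K * del by rewrite ler_wpM2l ?(ltW K0)//; lra.
  have : 0 <= (K - 1) * del by rewrite mulr_ge0 ?subr_ge0// ltW.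
  by lra.
have [rel1 E'] :=
  H' _ _ _ _ rt rt' (lt_le_trans qd del2) (lt_le_trans q'd del2).
have [rel2 E] := H _ _ _ _ lt lt' (close _ _ td qd) (close _ _ t'd q'd).
split; first exact: rel_trans rel2.
move: E' E; rewrite -!linearB/=.
have -> : (t - t') *m col_mx A A' =
    lsubmx (t - t') *m A + rsubmx (t - t') *m A'.
  by rewrite -{1}[t - t']hsubmxK mul_row_col.
have Ku := KA' (rsubmx (t - t')).
move: (lsub_le (t - t')) (rsub_le (t - t')) Ku.
move: (lsubmx (t - t')) (rsubmx (t - t')) => dl dr ldt rdt Kdr E' E.
set Q := g' (rsubmx t) q in E E' *; set Q' := g' (rsubmx t') q' in E E' *.
set G := g _ Q in E *; set G' := g _ Q' in E *.
have -> : G - G' - (q - q') - (dl *m A + dr *m A') =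
  (G - G' - (Q - Q') - dl *m A) + (Q - Q' - (q - q') - dr *m A').
  by apply/rowP => j; rewrite !mxE; ring.
rewrite (le_trans (ler_normD _ _))// mulrDl [leRHS]addrC lerD//; last first.
  by rewrite (le_trans E')// ler_wpM2l// lerD2r.
rewrite (le_trans E)// -mulrA ler_wpM2l//.
have -> : Q - Q' = (q - q') + dr *m A' + (Q - Q' - (q - q') - dr *m A').
  by apply/rowP => j; rewrite !mxE; ring.
have := ler_normD (q - q' + dr *m A') (Q - Q' - (q - q') - dr *m A').
have := ler_normD (q - q') (dr *m A').
move: E' Kdr ldt rdt (normr_ge0 dr) (normr_ge0 (q - q')) (normr_ge0 dl).
move: `|Q - Q' - _ - _| `|q - q' + _ + _| `|dr *m A'| `|q - q' + dr *m A'|.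
move: `|q - q'| `|t - t'| `|dr| `|dl| => dq dt r l a b c d3.
move=> *.
have : e' * (r + dq) <= r + dq by rewrite ler_piMl// addr_ge0.
have : K * r <= K * dt by rewrite ler_wpM2l ?(ltW K0)//.
have : dq <= K * dq by rewrite ler_peMl.
by lra.
Qed.

Lemma attain_lin d d' (A : 'M[R]_(d, n)) (B : 'M[R]_(d', d)) :
  attain A -> attain (B *m A).
Proof.
move=> aA e e0; have [K K1 BK] := mulmx_bounded B.
have K0 : 0 < K by rewrite (lt_le_trans ltr01).
rewrite -(divfK (lt0r_neq0 K0) e); apply: reach_lin => //; last first.
  by apply: aA; rewrite divr_gt0.
by rewrite ltW// divr_gt0.
Qed.

Lemma attain_cat d d' (A : 'M[R]_(d, n)) (A' : 'M[R]_(d', n)) :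
  attain A -> attain A' -> attain (col_mx A A').
Proof.
move=> aA aA' e e0; have [K K1 AK] := mulmx_bounded A'.
have K2 : 0 < 2 * (2 + K) by rewrite mulr_gt0// addr_gt0// (lt_le_trans ltr01).
pose e' := Num.min (e / 2) 1.
have e'0 : 0 < e' by rewrite lt_min divr_gt0// ltr01.
have e1 : 0 < e / (2 * (2 + K)) by rewrite divr_gt0.
apply: (@reach_le _ _ (e' + e / (2 * (2 + K)) * (2 + K))); last first.
  apply: reach_cat => //; first exact: ltW.
  - by rewrite (ltW e'0) ge_min lexx orbT.
  - exact: aA.
  - exact: aA'.
have : e' <= e / 2 by rewrite ge_min lexx.
have -> : e / (2 * (2 + K)) * (2 + K) = e / 2 by field; lra.
by lra.
Qed.

(** The moves along the rows are performed one after the other, with one parameter for each. *)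
Lemma attain_rows d (A : 'M[R]_(d, n)) :
  (forall i, attain (row i A)) -> attain A.
Proof.
elim: d A => [|d IH] A HA.
  move=> e e0; exists (fun _ q => q); split => //; exists 1 => // t t' q q' *.
  split => //; rewrite [A]flatmx0 mulmx0 subr0 subrr normr0.
  by rewrite mulr_ge0 ?addr_ge0// ltW.
have AE : A = col_mx (usubmx (A : 'M[R]_(1 + d, n)))
    (dsubmx (A : 'M[R]_(1 + d, n))).
  by rewrite (@vsubmxK _ 1 d n).
rewrite AE; apply: (@attain_cat 1 d).
  have -> : usubmx (A : 'M[R]_(1 + d, n)) = row ord0 A.
    apply/rowP => j; rewrite !mxE; congr (A _ j); exact/val_inj.
  exact: HA.
apply: IH => i.
have -> : row i (dsubmx (A : 'M[R]_(1 + d, n))) = row (rshift 1 i) A.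
  by apply/rowP => j; rewrite !mxE.
exact: HA.
Qed.

Lemma attain0 d : attain (0 : 'M[R]_(d, n)).
Proof.
move=> e e0; exists (fun _ q => q); split => //; exists 1 => // t t' q q' *.
split => //; rewrite mulmx0 subr0 subrr normr0.
by rewrite mulr_ge0 ?addr_ge0// ltW.
Qed.

(** Both moves run with the same parameter: the concatenation is restricted to the diagonal. *)
Lemma attainD d (A A' : 'M[R]_(d, n)) :
  attain A -> attain A' -> attain (A + A').
Proof.
move=> aA aA'; have := attain_lin (row_mx 1%:M 1%:M) (attain_cat aA aA').
by rewrite mul_row_col !mul1mx.
Qed.

Lemma attainZ (v : V) (c : R) : attain v -> attain (c *: v).
Proof. by move=> /(attain_lin c%:M); rewrite mul_scalar_mx. Qed.

End Reach.

(** * Conjugation of flows *)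

Section Bracket.
Context {R : realType} {n : nat}.
Local Notation V := 'rV[R]_n.

Lemma mulmx_rV1 (t : 'rV[R]_1) (v : V) : t *m v = t 0 0 *: v.
Proof. by rewrite [t]mx11_scalar mul_scalar_mx !mxE eqxx. Qed.

Lemma norm_rV1 (t : 'rV[R]_1) : `|t 0 0| = `|t|.
Proof.
apply/eqP; rewrite eq_le ler_coord_mxnorm/=.
by apply: mxnorm_le => // i j; rewrite !ord1.
Qed.

(** [Q], [Y], [Z] and [Gam] stand for the difference of two points at the start, after [phi (- s)],
    after [psi] and after [phi s]. Up to errors [Q] is [Y] times [1 + s J], [Gam] is [Z] times
    [1 + s J], and [Z - Y] is [tau *: g0]; so [Gam - Q] is [tau] times [g0 + s *: (g0 *m J)]. *)
Lemma conjugation_error (J : 'M[R]_n) (K s tau h G C0 : R)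
    (Y Z Q Gam g0 v : V) :
  (forall u : V, `|u *m J| <= K * `|u|) -> 0 <= K -> 0 <= s <= 1 ->
  0 <= h <= 1 -> 0 <= C0 ->
  `|Gam - Z - s *: (Z *m J)| <= h * s * `|Z| ->
  `|Q - Y - s *: (Y *m J)| <= h * s * `|Y| ->
  `|Z - Y - tau *: g0| <= h * s * (`|tau| + `|Y|) ->
  `|Y| <= 2 * `|Q| -> `|g0| <= G ->
  `|g0 + s *: (g0 *m J) - v| <= h * s * C0 ->
  `|Gam - Q - tau *: v| <=
    h * s * (2 * (1 + K) + G + 7 + C0) * (`|tau| + `|Q|).
Proof.
move=> JK K0 /andP[s0 s1] /andP[h0 h1] C00 E1 E2 E3 YQ g0G Ev.
set e1 := Gam - Z - _ in E1; set e2 := Q - Y - _ in E2.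
set e3 := Z - Y - _ in E3; set e4 := g0 + _ - v in Ev.
have -> : Gam - Q - tau *: v = e3 + s *: (e3 *m J) + (e1 - e2) + tau *: e4.
  rewrite /e1 /e2 /e3 /e4 !mulmxBl -scalemxAl.
  move: (Z *m J) (Y *m J) (g0 *m J) => a b c.
  by apply/rowP => j; rewrite !mxE; ring.
have hs0 : 0 <= h * s by rewrite mulr_ge0.
have hs1 : h * s <= 1 by nra.
have T := ler_normD (e3 + s *: (e3 *m J) + (e1 - e2)) (tau *: e4).
have T1 := ler_normD (e3 + s *: (e3 *m J)) (e1 - e2).
have T2 := ler_normD e3 (s *: (e3 *m J)).
have T3 := ler_normB e1 e2.
have T4 : `|tau *: e4| <= h * s * C0 * `|tau|.
  by rewrite normrZ mulrC ler_wpM2r.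
have T5 : `|s *: (e3 *m J)| <= K * `|e3|.
  rewrite normrZ ger0_norm// (le_trans _ (JK e3))// ler_piMl//.
have T6 : K * `|e3| <= K * (h * s * (`|tau| + `|Y|)) by rewrite ler_wpM2l.
have T7 : `|Z| <= `|Y| + `|tau| * G + (`|tau| + `|Y|).
  have -> : Z = Y + tau *: g0 + e3.
    by rewrite /e3; apply/rowP => j; rewrite !mxE; ring.
  have := ler_normD (Y + tau *: g0) e3; have := ler_normD Y (tau *: g0).
  have : `|tau *: g0| <= `|tau| * G by rewrite normrZ ler_wpM2l.
  have : h * s * (`|tau| + `|Y|) <= `|tau| + `|Y|.
    by rewrite ler_piMl// addr_ge0.
  by lra.
have T8 : h * s * `|Z| <= h * s * (4 * `|Q| + (G + 1) * `|tau|).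
  by rewrite ler_wpM2l//; lra.
have T9 : h * s * `|Y| <= h * s * (2 * `|Q|) by rewrite ler_wpM2l.
have T10 : K * (h * s * (`|tau| + `|Y|)) <= K * (h * s * (`|tau| + 2 * `|Q|)).
  by rewrite ler_wpM2l// ler_wpM2l// lerD2l.
have T11 : 0 <= h * s * `|tau| by rewrite mulr_ge0.
have T12 : 0 <= h * s * `|Q| by rewrite mulr_ge0.
have T13 : 0 <= K * (h * s * `|tau|) by rewrite mulr_ge0.
have T15 : 0 <= G * (h * s * `|Q|) by rewrite mulr_ge0// (le_trans _ g0G).
have T16 : 0 <= C0 * (h * s * `|Q|) by rewrite mulr_ge0.
move: T T1 T2 T3 T4 T5 T6 T8 T9 T10 T11 T12 T13 T15 T16 E1 E2 E3.
by lra.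
Qed.

Variables (rel : V -> V -> Prop) (p : V).
Hypothesis rel_trans : forall x y z, rel x y -> rel y z -> rel x z.

Lemma attain_flow (f : V -> V) U phi r L M : flow_box f U p phi r L M ->
  (forall q (t : R), `|q - p| < r -> `|t| < r -> rel q (phi t q)) ->
  attain rel p (f p).
Proof.
move=> box rel_phi e e0.
have r0 := fb_r box.
have [|d d0 H] := flow_strict box (y0 := p) _ e0; first by rewrite subrr normr0.
exists (fun t q => phi (t 0 0) q); split; first by rewrite mxE (fb_0 box).
have dr : Num.min d r <= d /\ Num.min d r <= r by rewrite !ge_min !lexx orbT.
exists (Num.min d r) => [|t t' q q']; first by rewrite lt_min d0.
rewrite -!norm_rV1 !lt_min.
move=> /andP[td tr] /andP[t'd _] /andP[qd qr] /andP[q'd _].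
split; first exact: rel_phi.
by rewrite mulmx_rV1 !mxE; exact: H.
Qed.

(* Conjugating the flow of [g] by the flow of [f] at time [s] gives velocity
   [g p + s *: [f, g] p + o(s)] with error only [e * s], so that the bracket
   is still visible after subtracting [g p] and dividing by [s]. *)
Lemma reach_conjugate (f g : V -> V) Jf Jg U U' phi psi r r' L L' M M' :
  strict_diff f p Jf -> strict_diff g p Jg ->
  flow_box f U p phi r L M -> flow_box g U' p psi r' L' M' ->
  (forall q (t : R), `|q - p| < r -> `|t| < r -> rel q (phi t q)) ->
  (forall q (t : R), `|q - p| < r' -> `|t| < r' -> rel q (psi t q)) ->
  forall e, 0 < e -> exists2 s, 0 < s <= 1 &
    reach rel p (g p + s *: (g p *m Jf - f p *m Jg)) (e * s).
Proof.
move=> sf sg box box' rel_phi rel_psi e e0.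
have [K K1 JK] := mulmx_bounded Jf; have [Kg Kg1 JgK] := mulmx_bounded Jg.
have K0 : 0 < K by rewrite (lt_le_trans ltr01).
have Kg0 : 0 < Kg by rewrite (lt_le_trans ltr01).
have r0 := fb_r box; have r'0 := fb_r box'.
have M0 := fb_M box; have M'0 := fb_M box'.
(* [C0] and [G] are the bounds proved below as [Ev] and [g0G]; [C] is the resulting constant of
   [conjugation_error], absorbed by [h * C <= e]. *)
pose C0 := M + Kg + 1; pose G := `|g p| + 1.
pose C := 2 * (1 + K) + G + 7 + C0.
have C00 : 0 <= C0 by rewrite /C0; lra.
have C_gt0 : 0 < C by rewrite /C /G; have := normr_ge0 (g p); lra.
pose h := Num.min (e / C) 1.
have h0 : 0 < h by rewrite lt_min divr_gt0// ltr01.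
have h1 : h <= 1 by rewrite ge_min lexx orbT.
have hC : h * C <= e by rewrite -ler_pdivlMr// ge_min lexx.
pose D := M + Kg + `|f p| * Kg.
have D0 : 0 <= D.
  by rewrite /D; have := mulr_ge0 (normr_ge0 (f p)) (ltW Kg0); lra.
have [d1 d10 lin] := flow_linearized box sf h0.
have [dg dg0 strg] := sg _ h0.
have [|dp dp0 strf] := flow_strict box (y0 := p) _ h0.
  by rewrite subrr normr0.
pose m := Num.min (Num.min d1 r) (Num.min r' dg).
have m0 : 0 < m by rewrite !lt_min d10 r0 r'0.
have [md1 mr mr' mdg] : [/\ m <= d1, m <= r, m <= r' & m <= dg].
  by rewrite /m !ge_min !lexx ?orbT.
near (0 : R)^'+ => s.
have s0 : 0 < s by [].
have s1 : s < 1 by near: s; apply: nbhs_right_lt.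
have sdp : s < dp by near: s; apply: nbhs_right_lt.
have sm : s < m / 2 / (M + 1).
  by near: s; apply: nbhs_right_lt; rewrite !divr_gt0// ltr_wpDl.
have sD : s <= h / (K * D + D + 1).
  near: s; apply: nbhs_right_le; rewrite divr_gt0// ltr_wpDl// addr_ge0//.
  by rewrite mulr_ge0// ltW.
rewrite ltr_pdivlMr ?ltr_wpDl// in sm.
have KD0 : 0 <= K * D by rewrite mulr_ge0// ltW.
rewrite ler_pdivlMr in sD; last by rewrite ltr_wpDl// addr_ge0.
have [sDh sKDh] : s * D <= h /\ s * (K * D) <= h.
  have := mulr_ge0 (ltW s0) D0; have := mulr_ge0 (ltW s0) KD0.
  by move: sD; rewrite !mulrDr mulr1; generalize s0; clear; lra.
have sm2 : s < m / 2.
  by rewrite (le_lt_trans _ sm)// ler_peMr ?(ltW s0)// lerDr.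
have sr : `|s| < r by rewrite gtr0_norm//; clear -sm2 m0 mr; lra.
have sNr : `|- s| < r by rewrite normrN.
have sd1 : `|s| < d1 by rewrite gtr0_norm//; clear -sm2 m0 md1; lra.
pose y0 := phi (- s) p.
have y0p : `|y0 - p| <= M * s.
  by have := flow_time0 box p sNr; rewrite normrN gtr0_norm.
have Ms : M * s < m / 2.
  by move: sm; rewrite mulrDr mulr1 (mulrC s M); generalize s0; clear; lra.
have y0r' : `|y0 - p| < r' by clear -y0p Ms mr' m0; lra.
have y0dg : `|y0 - p| < dg by clear -y0p Ms mdg m0; lra.
have pp (d : R) : 0 < d -> `|p - p| < d by rewrite subrr normr0.
have hs0 : 0 < h * s by rewrite mulr_gt0.
(* The tolerance is [h * s], since an error of order [s] would hide the bracket. *)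
have [d3 d30 strp] := flow_strict box' y0r' hs0.
(* The displacement from [p] to [y0], about [- s *: f p], produces the term [f p *m Jg] of the
   bracket; the term [g p *m Jf] comes from the final flow [phi s]. *)
have g0p : `|g y0 - g p + s *: (f p *m Jg)| <= h * s * (M + Kg).
  have A := strg _ _ y0dg (pp _ dg0).
  have B : `|y0 - p + s *: f p| <= h * s.
    have := strf p p (- s) 0; rewrite normrN gtr0_norm// normr0 !subrr.
    rewrite normr0 !subr0 (fb_0 box) addr0 normrN gtr0_norm// scaleNr opprK.
    by apply.
  have -> : g y0 - g p + s *: (f p *m Jg) =
      g y0 - g p - (y0 - p) *m Jg + (y0 - p + s *: f p) *m Jg.
    rewrite (mulmxDl (y0 - p)) -scalemxAl.
    move: ((y0 - p) *m Jg) (f p *m Jg) => a b.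
    by apply/rowP => j; rewrite !mxE; ring.
  rewrite (le_trans (ler_normD _ _))// mulrDr lerD//.
    by rewrite (le_trans A)// -mulrA ler_wpM2l ?(ltW h0)// mulrC.
  by rewrite (le_trans (JgK _))// mulrC ler_wpM2r// ltW.
have g0D : `|g y0 - g p| <= s * D.
  rewrite -[g y0 - g p](addrK (s *: (f p *m Jg))).
  rewrite (le_trans (ler_normB _ _))// normrZ gtr0_norm//.
  have : h * s * (M + Kg) <= s * (M + Kg).
    by rewrite ler_wpM2r ?ler_piMl ?(ltW s0)// addr_ge0// ltW.
  have : s * `|f p *m Jg| <= s * (Kg * `|f p|) by rewrite ler_wpM2l// ltW.
  by rewrite /D; generalize g0p; clear; lra.
have g0G : `|g y0| <= G.
  rewrite -[g y0](subrK (g p)) (le_trans (ler_normD _ _))// /G.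
  by clear -g0D sDh h1; lra.
have Ev : `|g y0 + s *: (g y0 *m Jf) - (g p + s *: (g p *m Jf - f p *m Jg))|
    <= h * s * C0.
  have -> : g y0 + s *: (g y0 *m Jf) - (g p + s *: (g p *m Jf - f p *m Jg)) =
      g y0 - g p + s *: (f p *m Jg) + s *: ((g y0 - g p) *m Jf).
    rewrite mulmxBl; move: (_ *m Jf) (_ *m Jf) (f p *m Jg) => a b c.
    by apply/rowP => j; rewrite !mxE; ring.
  rewrite (le_trans (ler_normD _ _))// /C0 mulrDr lerD// mulr1 mulrC.
  rewrite normrZ gtr0_norm// ler_wpM2l ?(ltW s0)// (le_trans (JK _))//.
  rewrite (le_trans _ sKDh)// mulrCA ler_wpM2l// ltW//.
(* [del] is chosen after [s], because [d3] depends on [s]. *)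
near (0 : R)^'+ => del.
have del0 : 0 < del by [].
have delM : del < m / 2 / (2 + M').
  by near: del; apply: nbhs_right_lt; rewrite !divr_gt0// ltr_wpDr.
have deld3 : del < d3 / 2.
  by near: del; apply: nbhs_right_lt; rewrite !divr_gt0.
have delm : del < m by near: del; apply: nbhs_right_lt.
rewrite ltr_pdivlMr ?ltr_wpDr// in delM.
exists s; first by rewrite s0 ltW.
exists (fun t q => phi s (psi (t 0 0) (phi (- s) q))); split.
  by rewrite mxE (fb_0 box') (fb_inv box).
exists del => // t t' q q'; rewrite mulmx_rV1 -!norm_rV1 !mxE.
move: (t 0 0) (t' 0 0) => {}t {}t' td t'd qd q'd.
have ynear x : `|x - p| < del -> `|phi (- s) x - y0| < d3 /\
    `|phi (- s) x - p| < 2 * del + m / 2.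
  move=> xd; have := flow_lip2 box x p sNr.
  have := ler_normD (phi (- s) x - y0) (y0 - p); rewrite subrKA /y0.
  rewrite -/y0; clear -xd deld3 y0p Ms; lra.
have znear u x : `|u| < del -> `|x - p| < del ->
    `|psi u (phi (- s) x) - p| < m.
  move=> ud xd; have [_ xm] := ynear _ xd.
  rewrite -(subrKA (phi (- s) x)) (le_lt_trans (ler_normD _ _))//.
  have ur' : `|u| < r' by clear -ud delm mr'; lra.
  have := flow_time0 box' (phi (- s) x) ur'.
  have : M' * `|u| <= M' * del by rewrite ler_wpM2l// ltW.
  by move: delM; rewrite mulrDr; clear -xm; lra.
have [yd3 ym] := ynear _ qd; have [y'd3 y'm] := ynear _ q'd.
have zm := znear _ _ td qd; have z'm := znear _ _ t'd q'd.
have delm2 : 2 * del <= m / 2.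
  have := mulr_ge0 (ltW del0) M'0; move: delM; rewrite mulrDr; clear; lra.
have E3 := strp _ _ _ _ (lt_trans td _) (lt_trans t'd _) yd3 y'd3.
split.
  have delr : del < r by clear -delm mr; lra.
  have ymm : `|phi (- s) q - p| < m by clear -ym delm2; lra.
  apply: (rel_trans (rel_phi q (- s) (lt_trans qd delr) sNr)).
  apply: (rel_trans (rel_psi _ t (lt_le_trans ymm mr') _)).
    exact: lt_le_trans (lt_trans td delm) mr'.
  exact: (rel_phi _ s (lt_le_trans zm mr)).
have qE x : phi s (phi (- s) x) = x by exact: (fb_inv box).
(* Writing [q] and [q'] as images under [phi s] lets the same expansion serve at the start ([E2])
   and at the end ([E1]). *)
rewrite -{2}(qE q) -{2}(qE q').
have E1 := lin _ _ s sd1 (lt_le_trans zm md1) (lt_le_trans z'm md1).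
have E2 : `|phi s (phi (- s) q) - phi s (phi (- s) q') -
    (phi (- s) q - phi (- s) q') -
    s *: ((phi (- s) q - phi (- s) q') *m Jf)| <=
    h * `|s| * `|phi (- s) q - phi (- s) q'|.
  have yd1 : `|phi (- s) q - p| < d1 by clear -ym delm2 md1; lra.
  have y'd1 : `|phi (- s) q' - p| < d1 by clear -y'm delm2 md1; lra.
  exact: lin.
have YQ := flow_lip2 box q q' sNr.
rewrite (gtr0_norm s0) !qE in E1 E2; rewrite !qE.
have s01 : 0 <= s <= 1 by rewrite !ltW.
have h01 : 0 <= h <= 1 by rewrite ltW.
have deld3' : del < d3 by clear -deld3 d30; lra.
have E3' := E3 deld3' deld3'.
have := conjugation_error JK (ltW K0) s01 h01 C00 E1 E2 E3' YQ g0G Ev.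
move/le_trans; apply; rewrite ler_wpM2r ?addr_ge0//.
by rewrite -/C mulrAC ler_wpM2r// ltW.
Unshelve. all: by end_near. Qed.

End Bracket.

(** * Brackets as velocities, and the open mapping argument *)

Section AttainBracket.
Context {R : realType} {n : nat}.
Local Notation V := 'rV[R]_n.
Variables (rel : V -> V -> Prop) (p : V).
Hypothesis rel_trans : forall x y z, rel x y -> rel y z -> rel x z.

(** The conjugated move is concatenated with a move along [- g p], run with the same parameter
    ([B]), and the parameter is divided by [s]. Both errors are [e1 * s], so what remains is
    [e1 * ((3 + K) * K')]. *)
Lemma attain_bracket (f g : V -> V) Jf Jg U U' phi psi r r' L L' M M' :
  strict_diff f p Jf -> strict_diff g p Jg ->
  flow_box f U p phi r L M -> flow_box g U' p psi r' L' M' ->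
  (forall q (t : R), `|q - p| < r -> `|t| < r -> rel q (phi t q)) ->
  (forall q (t : R), `|q - p| < r' -> `|t| < r' -> rel q (psi t q)) ->
  attain rel p (g p *m Jf - f p *m Jg).
Proof.
move=> sf sg box box' rel_phi rel_psi e e0; set b := _ - _.
have [K K1 gK] := mulmx_bounded (- g p).
pose B : 'M[R]_(1, 1 + 1) := row_mx 1%:M 1%:M.
have [K' K'1 BK] := mulmx_bounded B.
have K0 : 0 < K by rewrite (lt_le_trans ltr01).
have K'0 : 0 < K' by rewrite (lt_le_trans ltr01).
pose e1 := Num.min (e / ((3 + K) * K')) 1.
have e10 : 0 < e1 by rewrite lt_min divr_gt0 ?ltr01// mulr_gt0// addr_gt0.
have [s /andP[s0 s1] reach_s] :=
  reach_conjugate rel_trans sf sg box box' rel_phi rel_psi e10.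
have es0 : 0 < e1 * s by rewrite mulr_gt0.
have es1 : 0 <= e1 * s <= 1.
  by rewrite (ltW es0) mulr_ile1 ?(ltW e10) ?(ltW s0)// ge_min lexx orbT.
have reach_g : reach rel p (- g p) (e1 * s).
  have /(attainZ (-1)) := attain_flow box' rel_psi.
  by rewrite scaleN1r; apply.
have := reach_cat rel_trans (ltW es0) es1 K1 gK reach_s reach_g.
have E0 : 0 <= e1 * s + e1 * s * (2 + K).
  by rewrite addr_ge0 ?mulr_ge0 ?addr_ge0// ltW.
move=> /(reach_lin E0 K'1 BK).
rewrite mul_row_col !mul1mx addrAC subrr add0r => reach_b.
have sV (t : 'rV[R]_1) : `|t *m s^-1%:M| <= s^-1 * `|t|.
  by rewrite mul_mx_scalar normrZ gtr0_norm// invr_gt0.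
have s1V : 1 <= s^-1 by rewrite invf_ge1.
have E1 : 0 <= (e1 * s + e1 * s * (2 + K)) * K' by rewrite mulr_ge0// ltW.
move: reach_b => /(reach_lin E1 s1V sV).
rewrite mul_scalar_mx scalerA mulVf ?gt_eqF// scale1r; apply: reach_le.
have -> : (e1 * s + e1 * s * (2 + K)) * K' * s^-1 = e1 * ((3 + K) * K').
  by field; rewrite gt_eqF.
by rewrite -ler_pdivlMr ?mulr_gt0// ?addr_gt0// ge_min lexx.
Qed.

(** After the change of parameters [C], the map from [t] to [Pi (gam t p)] differs from a
    translation by a map with Lipschitz constant 1/2. A point [z] is hit where
    [H t = t - (Pi (F t) - z)] has a fixed point. *)
Lemma attain_open d m (A : 'M[R]_(d, n)) (C : 'M[R]_(m, d))
    (Pi : V -> 'rV[R]_m) (J : 'M[R]_(n, m)) (N : set V) :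
  attain rel p A -> strict_diff Pi p J -> C *m A *m J = 1%:M -> nbhs p N ->
  nbhs (Pi p) (Pi @` [set q | N q /\ rel p q]).
Proof.
move=> /(attain_lin C); move: (C *m A) => {A C d}A attA sPi AJ nN.
have [K K1 JK] := mulmx_bounded J; have [Ka Ka1 AK] := mulmx_bounded A.
have K0 : 0 < K by rewrite (lt_le_trans ltr01).
have Ka0 : 0 < Ka by rewrite (lt_le_trans ltr01).
(* The two tolerances are chosen so that the move and the nonlinearity of [Pi] contribute 1/4 each
   to the contraction constant. *)
have [|gam [gam0 [d1 d10 Hgam]]] := attA (4 * K)^-1.
  by rewrite invr_gt0 mulr_gt0.
have [|d2 d20 HPi] := sPi (4 * (Ka + 1))^-1.
  by rewrite invr_gt0 mulr_gt0// addr_gt0.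
have /nbhs_ballP[d3 /= d30 Nd3] := nN; rewrite -ball_normE in Nd3.
pose m0 := Num.min d2 d3.
have [m00 md2 md3] : [/\ 0 < m0, m0 <= d2 & m0 <= d3].
  by rewrite lt_min d20 !ge_min !lexx orbT.
have Ka10 : 0 < Ka + 1 by rewrite addr_gt0.
have [del [del0 dd1 dm]] : exists del, [/\ 0 < del, del < d1 &
    del * (Ka + 1) < m0].
  near (0 : R)^'+ => del; exists del; split; first by [].
    by near: del; apply: nbhs_right_lt.
  rewrite -ltr_pdivlMr//; near: del; apply: nbhs_right_lt.
  by rewrite divr_gt0.
pose F t := gam t p.
have pp : `|p - p| < d1 by rewrite subrr normr0.
have HF t t' : `|t| < d1 -> `|t'| < d1 -> rel p (F t) /\
    `|F t - F t' - (t - t') *m A| <= (4 * K)^-1 * `|t - t'|.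
  move=> td t'd; have [? ] := Hgam t t' p p td t'd pp pp.
  by rewrite subrr subr0 normr0 addr0.
have K41 : (4 * K)^-1 <= 1.
  by rewrite invf_le1 ?mulr_gt0//; lra.
have FL t t' : `|t| < d1 -> `|t'| < d1 -> `|F t - F t'| <= (Ka + 1) * `|t - t'|.
  move=> td t'd; have [_ H] := HF t t' td t'd.
  rewrite -[F t - F t'](subrK ((t - t') *m A)) (le_trans (ler_normD _ _))//.
  rewrite mulrDl addrC lerD// (le_trans H)// ler_wpM2r//.
have Fp t : `|t| <= del -> `|F t - p| < m0.
  move=> td; have := FL t 0 (le_lt_trans td dd1).
  rewrite normr0 subr0 /F gam0 => /(_ d10) /le_lt_trans; apply.
  by rewrite (le_lt_trans _ dm)// mulrC ler_wpM2r// ltW.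
have con t t' : `|t| <= del -> `|t'| <= del ->
    `|Pi (F t) - Pi (F t') - (t - t')| <= 2^-1 * `|t - t'|.
  move=> td t'd.
  have td1 := le_lt_trans td dd1; have t'd1 := le_lt_trans t'd dd1.
  have [_ H] := HF t t' td1 t'd1.
  have H2 := HPi _ _ (lt_le_trans (Fp _ td) md2) (lt_le_trans (Fp _ t'd) md2).
  have -> : Pi (F t) - Pi (F t') - (t - t') =
    Pi (F t) - Pi (F t') - (F t - F t') *m J +
    (F t - F t' - (t - t') *m A) *m J.
    by rewrite (mulmxBl (F t - F t')) -mulmxA AJ mulmx1 addrA subrK.
  rewrite (le_trans (ler_normD _ _))//.
  have H3 : (4 * (Ka + 1))^-1 * `|F t - F t'| <= 4^-1 * `|t - t'|.
    rewrite invfM -mulrA ler_wpM2l// mulrC ler_pdivrMr// mulrC.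
    exact: FL.
  have H4 : K * `|F t - F t' - (t - t') *m A| <= 4^-1 * `|t - t'|.
    rewrite (le_trans (ler_wpM2l (ltW K0) H))// mulrA invfM mulrCA.
    by rewrite mulfV ?mulr1// gt_eqF.
  have H5 := JK (F t - F t' - (t - t') *m A).
  by generalize H2 H3 H4 H5; clear; lra.
(* With [z] within [del / 2] of [Pi p], the contraction [H] maps the closed ball of radius [del]
   into itself. *)
apply/nbhs_ballP; exists (del / 2) => [|z]; first by rewrite /= divr_gt0.
rewrite -ball_normE/= => zp.
pose D := [set t : 'rV[R]_m | `|t| <= del].
pose H t := t - (Pi (F t) - z).
have Hfun : set_fun D D H.
  move=> t td; rewrite /D/= -[H t](subrK (H 0)) (le_trans (ler_normD _ _))//.
  have D0 : `|0 : 'rV[R]_m| <= del by rewrite normr0 ltW.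
  have := con t 0 td D0.
  have -> : H t - H 0 = - (Pi (F t) - Pi (F 0) - (t - 0)).
    by rewrite /H; apply/rowP => j; rewrite !mxE; ring.
  have -> : `|H 0| = `|Pi p - z| by rewrite /H /F gam0 add0r normrN.
  by rewrite normrN subr0; move: td zp; rewrite /D/=; clear; lra.
pose Hf : {fun D >-> D} := HB.pack H (isFun.Build _ _ _ _ H Hfun).
have [|||t Dt tH] := @banach_fixed_point R _ D Hf.
- have h2 : (0 : R) <= 2^-1 by [].
  exists (NngNum h2); split; first by rewrite /= invf_lt1// ltr1n.
  move=> [t t'] [/= td t'd].
  rewrite /= -normrN.
  have -> : - (H t - H t') = Pi (F t) - Pi (F t') - (t - t').
    by rewrite /H; apply/rowP => j; rewrite !mxE; ring.
  exact: con.
- apply: (@preimage_closed _ _ (fun t : 'rV[R]_m => `|t|) [set x | x <= del]).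
    by move=> x _; exact: norm_continuous.
  exact: closed_le.
- by exists 0; rewrite /D/= normr0 ltW.
exists (F t); last first.
  move: tH; rewrite /= /H -[LHS]subr0 => /addrI/oppr_inj/esym/subr0_eq; exact.
split; last by have [] := HF t t (le_lt_trans Dt dd1) (le_lt_trans Dt dd1).
by apply: Nd3; rewrite /= distrC (lt_le_trans (Fp _ Dt)).
Unshelve. all: by end_near. Qed.

End AttainBracket.

(** * Functions of class C^k *)

Section CkGeneral.
Context {R : realType} {V W : normedModType R}.
Implicit Types (U : set V) (f g : V -> W).

Lemma near0_differentiable f x :
  (\forall y \near x, f y = 0) -> differentiable f x.
Proof.
move=> f0; have f0x := nbhs_singleton f0.
have H : f \o shift x = cst (f x) + \0 +o_ 0 id.
  apply/eqaddoP => e e0.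
  have := f0; rewrite (near_shift 0 x) => /=; apply: filterS => y /=.
  rewrite subr0 !fctE f0x => ->.
  by rewrite /= addr0 subr0 normr0 mulr_ge0// ltW.
have c0 : continuous (\0 : V -> W) by exact: cst_continuous.
by apply/diff_locallyP; rewrite (diff_unique c0 H).
Qed.

Lemma near_eq_differentiable f g x :
  (\forall y \near x, f y = g y) -> differentiable f x -> differentiable g x.
Proof.
move=> fg df; rewrite (_ : g = f + (g - f)); last by rewrite addrC subrK.
apply: differentiableD => //; apply: near0_differentiable.
by apply: filterS fg => y; rewrite !fctE => ->; rewrite subrr.
Qed.

(** On the domain [[set x]], [Ck] still speaks of derivatives of functions on the whole space and
    only tests them at [x]. It is therefore a condition on the germ at [x]. *)
Lemma Ck_near x k f g :
  (\forall y \near x, f y = g y) -> Ck k [set x] f -> Ck k [set x] g.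
Proof.
elim: k f g => [|k IH] f g fg /=.
  move=> cf _ ->; have : f @ x --> f x by exact: cf.
  rewrite (nbhs_singleton fg) => fgx; apply: cvg_trans fgx.
  by apply: near_eq_cvg; apply: filterS fg => y ->.
move=> [df Df]; split.
  by move=> _ ->; exact: near_eq_differentiable fg (df x erefl).
move=> v; apply: IH (Df v).
have := near_join fg; apply: filterS => y; exact: near_eq_derive.
Qed.

Lemma Ck_pointP U k f : Ck k U f <-> forall x, U x -> Ck k [set x] f.
Proof.
split.
  elim: k f => [|k IH] f /= => [cf x Ux _ -> //|[df Df] x Ux]; first exact: cf.
  split=> [_ -> |v]; [exact: df|exact: IH].
elim: k f => [|k IH] f /= H => [x Ux|]; first exact: (H x Ux x).
split=> [x Ux|v]; first by have [+ _] := H x Ux; exact.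
by apply: IH => x Ux; have [_] := H x Ux; exact.
Qed.

Lemma Ck_subset U U' k f : U' `<=` U -> Ck k U f -> Ck k U' f.
Proof. by move=> UU' /Ck_pointP H; apply/Ck_pointP => x /UU'; exact: H. Qed.

Lemma Ck_eq U k f g : open U -> (forall x, U x -> f x = g x) ->
  Ck k U f -> Ck k U g.
Proof.
move=> oU fg /Ck_pointP H; apply/Ck_pointP => x Ux.
apply: Ck_near (H x Ux); have : \forall y \near x, U y by exact: open_nbhs_nbhs.
exact: filterS.
Qed.

Lemma Ck_S U k f : Ck k.+1 U f -> Ck k U f.
Proof.
elim: k f => [|k IH] f [df Df] /=.
  by move=> x /df; exact: differentiable_continuous.
by split => // v; apply: IH; exact: Df.
Qed.

Lemma Ck_cst U k (a : W) : Ck k U (fun=> a).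
Proof.
elim: k a => [|k IH] a /=; first by move=> x _; exact: cvg_cst.
split=> [x _|v]; first exact: differentiable_cst.
have -> : (fun x : V => 'D_v (fun=> a) x) = (fun=> 0); last exact: IH.
by apply/funext => x; exact: derive_cst.
Qed.

Lemma CkD U k f g : open U -> Ck k U f -> Ck k U g ->
  Ck k U (fun x => f x + g x).
Proof.
move=> oU; elim: k f g => [|k IH] f g /=.
  by move=> cf cg x Ux; apply: cvgD; [exact: cf|exact: cg].
move=> [df Df] [dg Dg]; split => [x Ux|v].
  by apply: differentiableD; [exact: df|exact: dg].
apply: (Ck_eq (f := fun x => 'D_v f x + 'D_v g x)) => //; last exact: IH.
move=> x Ux; rewrite -deriveD//; apply: diff_derivable; [exact: df|exact: dg].
Qed.

Lemma Ck_sum U k (I : finType) (F : I -> V -> W) : open U ->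
  (forall i, Ck k U (F i)) -> Ck k U (fun x => \sum_i F i x).
Proof.
move=> oU CF; rewrite unlock; elim: (index_enum I) => [|i s IH] /=.
  exact: Ck_cst.
by apply: CkD.
Qed.

End CkGeneral.

Section CkScalar.
Context {R : realType} {V : normedModType R}.
Implicit Types (U : set V) (f g : V -> R).

Lemma CkM U k f g : open U -> Ck k U f -> Ck k U g ->
  Ck k U (fun x => f x * g x).
Proof.
move=> oU; elim: k f g => [|k IH] f g.
  by move=> cf cg x Ux; apply: cvgM; [exact: cf|exact: cg].
move=> Cf Cg; have Cf' := Ck_S Cf; have Cg' := Ck_S Cg.
case: Cf Cg => [df Df] [dg Dg]; split => [x Ux|v].
  by apply: differentiableM; [exact: df|exact: dg].
apply: (Ck_eq (f := fun x => f x * 'D_v g x + g x * 'D_v f x)) => //.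
  move=> x Ux; rewrite -[RHS]/('D_v (f * g) x) deriveM//.
    exact/diff_derivable/df.
  exact/diff_derivable/dg.
by apply: CkD => //; apply: IH => //; [exact: Dg|exact: Df].
Qed.

Lemma Ck_prod U k (I : finType) (F : I -> V -> R) : open U ->
  (forall i, Ck k U (F i)) -> Ck k U (fun x => \prod_i F i x).
Proof.
move=> oU CF; rewrite unlock; elim: (index_enum I) => [|i s IH] /=.
  exact: Ck_cst.
by apply: CkM.
Qed.

End CkScalar.

Section CkMatrix.
Context {R : realType} {V : normedModType R}.

Lemma differentiable_mx m n (f : V -> 'M[R]_(m, n)) x :
  (forall i j, differentiable (fun y => f y i j) x) -> differentiable f x.
Proof.
move=> df.
have -> : f = \sum_i \sum_j (fun y => f y i j *: delta_mx i j).
  apply/funext => y; rewrite {1}[f y]matrix_sum_delta fct_sumE.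
  by apply: eq_bigr => i _; rewrite fct_sumE.
apply: differentiable_sum => i; apply: differentiable_sum => j.
exact: differentiableZl.
Qed.

Lemma Ck_mxP m n (U : set V) k (f : V -> 'M[R]_(m, n)) : open U ->
  (forall i j, Ck k U (fun y => f y i j)) -> Ck k U f.
Proof.
move=> oU; elim: k f => [|k IH] f Cf.
  move=> x Ux; apply/(@cvgrPdist_le _ _ _ (nbhs x)) => e e0.
  have near_ij (ij : 'I_m * 'I_n) : \forall y \near x,
      `|f x ij.1 ij.2 - f y ij.1 ij.2| <= e.
    by have /cvgrPdist_le/(_ _ e0) := Cf ij.1 ij.2 x Ux.
  near=> y; apply: mxnorm_le => [|i j]; first exact: ltW.
  rewrite !mxE; have H : forall ij : 'I_m * 'I_n,
      `|f x ij.1 ij.2 - f y ij.1 ij.2| <= e by near: y; exact: filter_forall.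
  exact: (H (i, j)).
split=> [x Ux|v].
  by apply: differentiable_mx => i j; have [+ _] := Cf i j; exact.
apply: IH => i j; have [df /(_ v)] := Cf i j.
apply: Ck_eq => // x Ux; rewrite derive_mx ?mxE//.
apply: diff_derivable; apply: differentiable_mx => i' j'.
by have [+ _] := Cf i' j'; exact.
Unshelve. all: by end_near. Qed.

Lemma Ck_coord m n (U : set V) k (f : V -> 'M[R]_(m, n)) i j : open U ->
  Ck k U f -> Ck k U (fun y => f y i j).
Proof.
move=> oU; elim: k f => [|k IH] f Cf.
  move=> x Ux.
  apply: (@continuous_comp _ _ _ f (fun A : 'M[R]_(m, n) => A i j)).
    exact: Cf.
  exact: coord_continuous.
case: Cf => df Df; split=> [x Ux|v].
  apply: (@differentiable_comp _ _ _ _ f (fun A : 'M[R]_(m, n) => A i j)).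
    exact: df.
  exact: differentiable_coord.
apply: (Ck_eq oU _ (IH _ (Df v))) => x Ux.
by rewrite derive_mx ?mxE//; apply: diff_derivable; exact: df.
Qed.

Lemma Ck_mulmx m n l (U : set V) k (f : V -> 'M[R]_(m, n))
    (g : V -> 'M[R]_(n, l)) : open U ->
  Ck k U f -> Ck k U g -> Ck k U (fun x => f x *m g x).
Proof.
move=> oU Cf Cg; apply: Ck_mxP => // i j.
apply: (@Ck_eq _ _ _ U k (fun x => \sum_l0 f x i l0 * g x l0 j)) => //.
  by move=> x _; rewrite mxE.
by apply: Ck_sum => // a; apply: CkM => //; exact: Ck_coord.
Qed.

Lemma Ck_trmx m n (U : set V) k (f : V -> 'M[R]_(m, n)) : open U ->
  Ck k U f -> Ck k U (fun x => (f x)^T).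
Proof.
move=> oU Cf; apply: Ck_mxP => // i j.
apply: (Ck_eq oU _ (Ck_coord j i oU Cf)) => x _.
by rewrite mxE.
Qed.

Lemma Ck_det n (U : set V) k (f : V -> 'M[R]_n) : open U ->
  Ck k U f -> Ck k U (fun x => \det (f x)).
Proof.
move=> oU Cf; apply: Ck_sum => // s; apply: CkM => //; first exact: Ck_cst.
by apply: Ck_prod => // i; exact: Ck_coord.
Qed.

Lemma Ck_adj n (U : set V) k (f : V -> 'M[R]_n) : open U ->
  Ck k U f -> Ck k U (fun x => \adj (f x)).
Proof.
move=> oU Cf; apply: Ck_mxP => // i j.
apply: (@Ck_eq _ _ _ U k (fun x => (-1) ^+ (j + i) *
   \det (row' j (col' i (f x))))) => //.
  by move=> x _; rewrite mxE.
apply: CkM => //; first exact: Ck_cst.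
apply: Ck_det => //; apply: Ck_mxP => // a b.
apply: (Ck_eq oU _ (Ck_coord (lift j a) (lift i b) oU Cf)) => x _.
by rewrite !mxE.
Qed.

(* On an open set, the differential of the composite is a sum of products of
   functions that are one degree less smooth. *)
Lemma Ck_comp_scalar n (U : set V) (U' : set 'rV[R]_n) k (f : V -> 'rV[R]_n)
    (g : 'rV[R]_n -> R) : open U -> open U' -> (forall x, U x -> U' (f x)) ->
  Ck k U f -> Ck k U' g -> Ck k U (g \o f).
Proof.
move=> oU oU' UU'; elim: k g => [|k IH] g.
  move=> cf cg x Ux; apply: continuous_comp; [exact: cf|exact/cg/UU'].
move=> Cf [dg Dg]; have Cf' := Ck_S Cf; have [df Df] := Cf.
have dgf x : U x -> differentiable (g \o f) x.
  by move=> Ux; apply: differentiable_comp; [exact: df|exact/dg/UU'].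
split => // v.
apply: (Ck_eq (f := fun x => \sum_i 'D_v f x 0 i *
   ((fun y => 'D_(delta_mx 0 i) g y) \o f) x)) => //; last first.
  apply: Ck_sum => // i; apply: CkM => //.
    exact: (Ck_coord 0 i oU (Df v)).
  by apply: IH => //; exact: Dg.
move=> x Ux; rewrite (deriveE _ (dgf x Ux)).
rewrite diff_comp; [|exact: df|exact/dg/UU'].
rewrite /= -(deriveE _ (df x Ux)) {2}['D_v f x]row_sum_delta linear_sum.
apply: eq_bigr => i _; rewrite linearZ/= -deriveE//.
exact/dg/UU'.
Qed.

End CkMatrix.

Section CkComp.
Context {R : realType} {V : normedModType R}.

Lemma Ck_comp n m l (U : set V) (U' : set 'rV[R]_n) k (f : V -> 'rV[R]_n)
    (g : 'rV[R]_n -> 'M[R]_(m, l)) :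
  open U -> open U' -> (forall x, U x -> U' (f x)) ->
  Ck k U f -> Ck k U' g -> Ck k U (g \o f).
Proof.
move=> oU oU' UU' Cf Cg; apply: Ck_mxP => // i j.
exact: (Ck_comp_scalar oU oU' UU' Cf (Ck_coord i j oU' Cg)).
Qed.

End CkComp.

Section CkCurve.
Context {R : realType} {n : nat}.

(** Bootstrap: the derivative of [c] is [f \o c], which is as smooth as [c], so each round gains one
    degree. *)
Lemma solution_Ck (f : 'rV[R]_n -> 'rV[R]_n) (U : set 'rV[R]_n)
    (I : set R^o) (c : R^o -> 'rV[R]_n) k : open U -> open I ->
  Ck k U f -> (forall t, I t -> U (c t)) ->
  (forall t : R, I t -> is_derive t 1 (c : R -> 'rV[R]_n) (f (c t))) ->
  Ck k I c.
Proof.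
move=> oU oI Cf Uc dc.
have diffc (t : R^o) : I t -> differentiable c t.
  by move=> /dc[H _]; apply/derivable1_diffP.
elim: k Cf => [|k IH] Cf.
  by move=> t /diffc; exact: differentiable_continuous.
have Cc := IH (Ck_S Cf); split => // v.
have : Ck k I (fun t => v%:M *m (f \o c) t).
  apply: Ck_mulmx => //; first exact: Ck_cst.
  exact: (Ck_comp oI oU Uc Cc (Ck_S Cf)).
apply: Ck_eq => // t It.
rewrite mul_scalar_mx (deriveE _ (diffc t It)).
rewrite -[v in RHS]mulr1 -[v * 1]/(v *: (1 : R^o)) linearZ; congr (_ *: _).
rewrite -(@deriveE _ _ _ _ _ (1 : R^o) (diffc t It)).
by have := dc t It => ?; rewrite derive_val.
Qed.

End CkCurve.

Lemma open_preimage_on (T T' : topologicalType) (U : set T) (V : set T')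
    (f : T -> T') : open U -> open V ->
  (forall x, U x -> {for x, continuous f}) -> open [set x | U x /\ V (f x)].
Proof.
rewrite !openE => oU oV cf x [Ux Vfx].
have := cf x Ux V (oV _ Vfx); have := oU _ Ux; exact: filterI.
Qed.

Section Affine.
Context {R : realType} {V V' W : normedModType R}.

(** The hypotheses say that [h] is affine with linear part [l]. It serves for changes of time and,
    in [act_smooth], for an inclusion into a product of charts. *)
Lemma Ck_affine k (U : set V) (f : V -> W) (h l : V' -> V) :
  (forall x, differentiable h x) ->
  (forall x v (t : R), h (t *: v + x) = t *: l v + h x) ->
  Ck k U f -> Ck k (h @^-1` U) (f \o h).
Proof.
move=> dh hl; elim: k f => [|k IH] f /=.
  move=> cf x Ux; apply: continuous_comp; last exact: cf.
  exact: differentiable_continuous.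
move=> [df Df]; split => [x Ux|v].
  by apply: (differentiable_comp (dh x)); exact: df.
have -> : (fun x => 'D_v (f \o h) x) = (fun x => 'D_(l v) f x) \o h.
  apply/funext => x; rewrite /= /derive.
  set u := (fun t : R => _); set w := (fun t : R => _).
  suff -> : u = w by [].
  by apply/funext => t; rewrite /u /w /= hl.
exact: IH.
Qed.

End Affine.

Lemma near_eq_diff (R : realType) (V W : normedModType R) (f g : V -> W) x v :
  differentiable f x ->
  (\forall y \near x, f y = g y) -> 'd g x v = 'd f x v.
Proof.
move=> df fg; have dg := near_eq_differentiable fg df.
by rewrite -(deriveE v dg) -(deriveE v df) (near_eq_derive _ fg).
Qed.

Lemma diff_comp_near (R : realType) (V W Z : normedModType R) (f : V -> W)
    (g : W -> Z) (h : V -> Z) x v :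
  differentiable f x -> differentiable g (f x) ->
  (\forall y \near x, g (f y) = h y) ->
  differentiable h x /\ 'd h x v = 'd g (f x) ('d f x v).
Proof.
move=> df dg gfh; have dgf := differentiable_comp df dg; split.
  exact: near_eq_differentiable gfh dgf.
by rewrite (near_eq_diff v dgf gfh) diff_comp.
Qed.

(** * Charts and curves *)

Section Charts.
Context {R : realType} {n : nat} {M : manifoldType R n}.
Implicit Types (p q r : M) (x : 'rV[R]_n).

Lemma cimg_open' p : open (cimg p : set 'rV[R]_n).
Proof. exact: cimg_open. Qed.

Lemma cimg_cmap p q : cdom p q -> cimg p (cmap p q).
Proof. by move=> pq; exists q. Qed.

Lemma cimg_self p : cimg p (cmap p p).
Proof. by apply: cimg_cmap; exact: cdom_self. Qed.

Lemma cinv_dom p x : cimg p x -> cdom p (cinv p x).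
Proof. by move=> [q pq <-]; rewrite cmapK. Qed.

Lemma cinvK p x : cimg p x -> cmap p (cinv p x) = x.
Proof. by move=> [q pq <-]; rewrite cmapK. Qed.

Lemma cinv_self p : cinv p (cmap p p) = p.
Proof. by rewrite cmapK//; exact: cdom_self. Qed.

Lemma open_chart_domain p (U : set M) : open U ->
  open [set x : 'rV[R]_n | cimg p x /\ U (cinv p x)].
Proof.
move=> oU; apply: open_preimage_on => //; first exact: cimg_open'.
by move=> x px; exact: cinv_continuous.
Qed.

Lemma cinv_nbhs p x (N : set M) : cimg p x -> nbhs (cinv p x) N ->
  \forall y \near x, cimg p y /\ N (cinv p y).
Proof.
move=> px nN; apply: filterI; last exact: (cinv_continuous _ _ px).
by apply: open_nbhs_nbhs; split => //; exact: cimg_open'.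
Qed.

Definition transit p q x : 'rV[R]_n := cmap q (cinv p x).

Lemma transit_differentiable p q x : cimg p x -> cdom q (cinv p x) ->
  differentiable (transit p q) x.
Proof.
by move=> px qx; have [+ _] := transition_smooth p q 1; apply; split.
Qed.

Lemma diff_transit_comp p q r x v : cimg p x -> cdom q (cinv p x) ->
  cdom r (cinv p x) ->
  'd (transit p r) x v =
  'd (transit q r) (transit p q x) ('d (transit p q) x v).
Proof.
move=> px qx rx.
have qr : cinv q (transit p q x) = cinv p x by rewrite /transit cmapK.
have d1 := transit_differentiable px qx.
have d2 : differentiable (transit q r) (transit p q x).
  apply: transit_differentiable; first exact: cimg_cmap.
  by rewrite qr.
suff eqn : \forall y \near x, transit q r (transit p q y) = transit p r y.
  exact: (diff_comp_near v d1 d2 eqn).2.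
have := cinv_nbhs px (open_nbhs_nbhs (conj (cdom_open q) qx)).
by apply: filterS => y [py qy]; rewrite /transit cmapK.
Qed.

Lemma diff_transit_id p x v : cimg p x -> 'd (transit p p) x v = v.
Proof.
move=> px; have d := transit_differentiable px (cinv_dom px).
have eqn : \forall y \near x, id y = transit p p y.
  have : \forall y \near x, cimg p y.
    by apply: open_nbhs_nbhs; split => //; exact: cimg_open'.
  by apply: filterS => y py; rewrite /transit cinvK.
have did : is_diff x (id : 'rV[R]_n -> 'rV[R]_n) id by exact: is_diff_id.
have -> := near_eq_diff v ex_diff eqn.
by rewrite -[RHS]/(id v); congr (_ v); exact: diff_val.
Qed.

Lemma diff_transitK p q x v : cimg p x -> cdom q (cinv p x) ->
  'd (transit q p) (transit p q x) ('d (transit p q) x v) = v.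
Proof.
move=> px qx; rewrite -diff_transit_comp//; last exact: cinv_dom.
exact: diff_transit_id.
Qed.

(* The passage from the chart [cmap p] to the preferred chart at [cinv p x]. *)
Definition to_tangent p x : 'rV[R]_n -> 'rV[R]_n :=
  'd (transit p (cinv p x)) x.

Definition of_tangent p x : 'rV[R]_n -> 'rV[R]_n :=
  'd (transit (cinv p x) p) (cmap (cinv p x) (cinv p x)).

Lemma of_tangentK p x v : cimg p x -> to_tangent p x (of_tangent p x v) = v.
Proof.
move=> px; rewrite /to_tangent /of_tangent.
have := @diff_transitK (cinv p x) p (cmap (cinv p x) (cinv p x)) v.
rewrite /transit cinv_self cinvK//; apply; first exact: cimg_self.
exact: cinv_dom.
Qed.

Lemma to_tangent_self p v : to_tangent p (cmap p p) v = v.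
Proof.
by rewrite /to_tangent cinv_self diff_transit_id//; exact: cimg_self.
Qed.

End Charts.

Section ChartMaps.
Context {R : realType} {n m : nat}.
Context {M : manifoldType R n} {N : manifoldType R m}.
Variable f : M -> N.
Hypothesis sf : smooth_map [set: M] f.

Definition chart_map (p : M) (r : N) (x : 'rV[R]_n) : 'rV[R]_m :=
  cmap r (f (cinv p x)).

Definition chart_map_dom (p : M) (r : N) : set 'rV[R]_n :=
  [set x | cimg p x /\ cdom r (f (cinv p x))].

Lemma smooth_map_continuous : continuous f.
Proof. by move=> p; exact: sf.1. Qed.

Lemma chart_map_dom_open p r : open (chart_map_dom p r).
Proof.
apply: (@open_chart_domain _ _ _ p [set q | cdom r (f q)]).
apply: (@open_comp _ _ f (cdom r)); last exact: cdom_open.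
by move=> q _; exact: smooth_map_continuous.
Qed.

Lemma chart_map_smooth p r : smooth_on (chart_map_dom p r) (chart_map p r).
Proof.
move=> k; apply: Ck_subset (sf.2 p r k) => x [px rx]; by split.
Qed.

Lemma chart_map_differentiable p r x : chart_map_dom p r x ->
  differentiable (chart_map p r) x.
Proof. by move=> xd; have [+ _] := chart_map_smooth p r 1; apply. Qed.

(** Near [x] the chart map factors through the preferred charts at [q = cinv p x] and [f q], in
    which [tmap] is defined. *)
Lemma diff_chart_map p r x v : chart_map_dom p r x ->
  'd (chart_map p r) x v =
  'd (transit (f (cinv p x)) r) (cmap (f (cinv p x)) (f (cinv p x)))
     (tmap f (cinv p x) (to_tangent p x v)).
Proof.
move=> [px rx]; set q := cinv p x.
have qself := cdom_self q; have fqself := cdom_self (f q).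
have tq : transit p q x = cmap q q by [].
have d1 : differentiable (transit p q) x by exact: transit_differentiable.
have d2 : differentiable (chart_map q (f q)) (transit p q x).
  apply: chart_map_differentiable; rewrite tq; split; first exact: cimg_self.
  by rewrite cinv_self.
have e2 : chart_map q (f q) (transit p q x) = cmap (f q) (f q).
  by rewrite tq /chart_map cinv_self.
have d3 : differentiable (transit (f q) r) (chart_map q (f q) (transit p q x)).
  rewrite e2; apply: transit_differentiable; first exact: cimg_self.
  by rewrite cinv_self.
have nN : nbhs (cinv p x) (cdom q `&` f @^-1` cdom (f q)).
  apply: filterI; first by apply: open_nbhs_nbhs; split => //; exact: cdom_open.
  apply: smooth_map_continuous; apply: open_nbhs_nbhs.
  by split => //; exact: cdom_open.
have near_x := cinv_nbhs px nN.
have eqn1 : \forall y \near x,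
    chart_map q (f q) (transit p q y) = chart_map p (f q) y.
  by apply: filterS near_x => y [py [qy fy]]; rewrite /transit /chart_map cmapK.
have eqn2 : \forall y \near x,
    transit (f q) r (chart_map p (f q) y) = chart_map p r y.
  by apply: filterS near_x => y [py [qy fy]]; rewrite /transit /chart_map cmapK.
have [d12 E12] := diff_comp_near v d1 d2 eqn1.
have e12 : chart_map p (f q) x = cmap (f q) (f q) by [].
rewrite e2 -e12 in d3.
by have [_ ->] := diff_comp_near v d12 d3 eqn2; rewrite E12 e12.
Qed.

End ChartMaps.

Lemma tmap_comp (R : realType) n m l (M : manifoldType R n)
    (N : manifoldType R m) (P : manifoldType R l)
    (f : M -> N) (g : N -> P) p v :
  smooth_map [set: M] f -> smooth_map [set: N] g ->
  tmap (g \o f) p v = tmap g (f p) (tmap f p v).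
Proof.
move=> sf sg.
have pf : chart_map_dom f p (f p) (cmap p p).
  by split; [exact: cimg_self|rewrite cinv_self; exact: cdom_self].
have d1 := chart_map_differentiable sf pf.
have e1 : chart_map f p (f p) (cmap p p) = cmap (f p) (f p).
  by rewrite /chart_map cinv_self.
have d2 : differentiable (chart_map g (f p) (g (f p)))
    (chart_map f p (f p) (cmap p p)).
  rewrite e1; apply: chart_map_differentiable => //.
  by split; [exact: cimg_self|rewrite cinv_self; exact: cdom_self].
have eqn : \forall y \near cmap p p,
    chart_map g (f p) (g (f p)) (chart_map f p (f p) y) =
    cmap (g (f p)) (g (f (cinv p y))).
  have oD : open (chart_map_dom f p (f p)) by exact: chart_map_dom_open.
  have := open_nbhs_nbhs (conj oD pf).
  by apply: filterS => y [py fy]; rewrite /chart_map cmapK.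
have [_ E] := diff_comp_near v d1 d2 eqn.
by move: E; rewrite e1.
Qed.

Lemma is_derive_affine (R : realType) (V : normedModType R) (f : R -> V)
    (a b t : R) (w : V) : is_derive (a * t + b) 1 f w ->
  is_derive t 1 (fun s : R => f (a * s + b)) (a *: w).
Proof.
move=> D.
have da : is_derive t 1 (fun s : R => a * s + b) a.
  have H1 := is_deriveZ a (is_derive_id t (1 : R)).
  have := is_deriveD H1 (is_derive_cst b t (1 : R)).
  by rewrite addr0 -[a *: 1]/(a * 1) mulr1.
have df : differentiable f (a * t + b).
  by apply/derivable1_diffP; exact: ex_derive.
apply: (is_derive_eq (is_derive_comp_curve da df)).
by rewrite (diff1E df) derive1E; congr (_ *: _); case: D.
Qed.

Section Curves.
Context {R : realType} {n : nat} {M : manifoldType R n}.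
Implicit Types (p q : M) (c : R -> M) (I : set R).

Lemma near_curve_dom c t p : {for t, continuous c} -> cdom p (c t) ->
  \forall s \near t, cdom p (c s).
Proof.
move=> ct pt; apply: ct; apply: open_nbhs_nbhs.
by split => //; exact: cdom_open.
Qed.

Lemma velocity_in_chart c (t : R) p u : {for t, continuous c} -> cdom p (c t) ->
  is_derive t 1 (fun s : R => cmap p (c s)) u ->
  velocity c t = 'd (transit p (c t)) (cmap p (c t)) u.
Proof.
move=> ct pt dc.
have dtr : differentiable (transit p (c t)) (cmap p (c t)).
  apply: transit_differentiable; first exact: cimg_cmap.
  by rewrite cmapK//; exact: cdom_self.
have D := is_derive_comp_curve dc dtr.
have eqn : \forall s \near t,
    (transit p (c t) \o (fun s => cmap p (c s))) s = cmap (c t) (c s).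
  apply: filterS (near_curve_dom ct pt) => s ps.
  by rewrite /transit /= cmapK.
have D' := near_eq_is_derive eqn D.
by rewrite /velocity derive1E derive_val.
Qed.

Lemma smooth_curve_derivable I c (t : R) p : smooth_curve I c -> I t ->
  cdom p (c t) ->
  is_derive t 1 (fun s : R => cmap p (c s))
    ('D_1 (fun s : R => cmap p (c s)) t).
Proof.
move=> [_ sc] It pt; have [+ _] := sc p 1%N.
move=> /(_ t (conj It pt)) d; apply: derivableP.
exact/derivable1_diffP.
Qed.

Lemma velocity_derive I c (t : R) : smooth_curve I c -> I t ->
  is_derive t 1 (fun s : R => cmap (c t) (c s)) (velocity c t).
Proof.
move=> sc It; rewrite /velocity derive1E.
exact: (smooth_curve_derivable sc It (cdom_self _)).
Qed.

Lemma curve_dom_open I c p : open I -> smooth_curve I c ->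
  open [set t : R^o | I t /\ cdom p (c t)].
Proof.
move=> oI [cc _]; apply: open_preimage_on => //; exact: cdom_open.
Qed.

Lemma smooth_curve_chart p I (x : R -> 'rV[R]_n) : open I ->
  smooth_on (I : set R^o) (x : R^o -> 'rV[R]_n) ->
  (forall t, I t -> cimg p (x t)) -> smooth_curve I (fun t => cinv p (x t)).
Proof.
move=> oI sx px; have cx t : I t -> {for t, continuous x} by exact: (sx 0%N t).
split=> [t It|q k].
  by apply: continuous_comp; [exact: cx|apply: cinv_continuous; exact: px].
pose U' := [set y : 'rV[R]_n | cimg p y /\ cdom q (cinv p y)].
have oU' : open U' by apply: open_chart_domain; exact: cdom_open.
have oI' : open ([set t | I t /\ cdom q (cinv p (x t))] : set R^o).
  rewrite (_ : [set _ | _] = [set t | I t /\ U' (x t)]).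
    exact: open_preimage_on.
  apply/seteqP; split => t [It]; last by move=> [_ qt].
  by move=> qt; split => //; split => //; exact: px.
apply: (@Ck_comp _ _ _ _ _ _ U' k (x : R^o -> _) (transit p q)) => //.
- by move=> t [It qt]; split => //; exact: px.
- by apply: Ck_subset (sx k) => t [].
- exact: (transition_smooth p q k).
Qed.

Lemma smooth_curve_affine I c (a b : R) : smooth_curve I c ->
  smooth_curve [set t | I (a * t + b)] (fun t => c (a * t + b)).
Proof.
move=> [cc sc].
have daff (t : R^o) : differentiable (fun t : R^o => a * t + b : R^o) t.
  apply/derivable1_diffP; apply: ex_derive.
split=> [t It|p k].
  apply: (@continuous_comp _ _ _ (fun t : R => a * t + b) c); last exact: cc.
  exact: differentiable_continuous (daff t).
have := @Ck_affine R R^o R^o _ k _ _ (fun t : R^o => a * t + b : R^o)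
  (fun v => a * v) daff _ (sc p k).
apply => t v s /=.
by rewrite -[s *: v]/(s * v) -[s *: _]/(s * (a * v)); ring.
Qed.

Lemma velocity_affine I c (a b t : R) : smooth_curve I c -> I (a * t + b) ->
  velocity (fun t => c (a * t + b)) t = a *: velocity c (a * t + b).
Proof.
move=> sc It; have D := velocity_derive sc It.
have := is_derive_affine D; rewrite {2}/velocity derive1E => D2.
exact: (@derive_val _ _ _ _ _ _ _ D2).
Qed.

End Curves.

Lemma smooth_curve_comp (R : realType) n m (M : manifoldType R n)
    (N : manifoldType R m) (f : M -> N) (I : set R) (c : R -> M) : open I ->
  smooth_map [set: M] f -> smooth_curve I c -> smooth_curve I (f \o c).
Proof.
move=> oI sf sc; have [cc _] := sc.
have cfc t : I t -> {for t, continuous (f \o c)}.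
  move=> It; apply: continuous_comp; first exact: cc.
  exact: smooth_map_continuous.
split=> // r k; apply/Ck_pointP => t [It rt].
set p := c t.
pose U' := chart_map_dom f p r.
have oU' : open U' by exact: chart_map_dom_open.
pose J := [set s : R^o | (I s /\ cdom p (c s)) /\ cdom r (f (c s))].
have oJ : open J.
  apply: open_preimage_on.
  - exact: curve_dom_open.
  - exact: cdom_open.
  - by move=> s [Is _]; exact: cfc.
have Jt : J t by split => //; split => //; exact: cdom_self.
have := @Ck_comp _ _ _ _ _ J U' k (fun s : R^o => cmap p (c s))
  (chart_map f p r) oJ oU'.
have UJ s : J s -> U' (cmap p (c s)).
  by move=> [[Is ps] rs]; split; [exact: cimg_cmap|rewrite cmapK].
have sck : Ck k J (fun s : R^o => cmap p (c s)).
  by apply: Ck_subset (sc.2 p k) => s [].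
move=> /(_ UJ sck (chart_map_smooth sf p r k)).
move=> /(Ck_eq (g := fun s : R^o => cmap r ((f \o c) s)) oJ) H.
apply: (Ck_pointP _ _ _).1 Jt; apply: H => s [[Is ps] rs].
by rewrite /= /chart_map cmapK.
Qed.

Lemma velocity_comp (R : realType) n m (M : manifoldType R n)
    (N : manifoldType R m) (f : M -> N) (I : set R) (c : R -> M) (t : R) :
  smooth_map [set: M] f -> smooth_curve I c -> I t ->
  velocity (f \o c) t = tmap f (c t) (velocity c t).
Proof.
move=> sf sc It; have D := velocity_derive sc It.
set p := c t in D *.
have dF : differentiable (chart_map f p (f p)) (cmap p p).
  apply: chart_map_differentiable => //; split; first exact: cimg_self.
  by rewrite cinv_self; exact: cdom_self.
have D2 := is_derive_comp_curve D dF.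
have eqn : \forall s \near t,
    (chart_map f p (f p) \o (fun s => cmap p (c s))) s = cmap (f p) (f (c s)).
  have := near_curve_dom (sc.1 t It) (cdom_self (c t)).
  by apply: filterS => s ps; rewrite /chart_map /= cmapK.
have D3 := near_eq_is_derive eqn D2.
by rewrite {1}/velocity derive1E /= derive_val.
Qed.

(** * Dual leaves *)

Section Leaves.
Context {R : realType} {n b : nat}.
Context {M : manifoldType R n} {B : manifoldType R b}.
Variables (g : riemannian M) (proj : M -> B).

Let leaf := dual_leaf g proj.

(** A single smooth arc of positive duration. The dual leaf relation is its reflexive transitive
    closure, by [dual_leaf_hstep] and [dual_leaf_ind]. *)
Definition hstep (q q' : M) := exists (t0 t1 : R) (I : set R) (d : R -> M),
  [/\ t0 < t1, open I /\ `[t0, t1]%classic `<=` I, smooth_curve I d,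
      (forall t, t0 <= t <= t1 -> horizontal g proj (d t) (velocity d t))
    & d t0 = q /\ d t1 = q'].

Lemma horizontalZ q a u : horizontal g proj q u -> horizontal g proj q (a *: u).
Proof.
move=> hu v /hu h; rewrite /inner /bilin -!scalemxAl mxE.
by rewrite [X in _ * X]h mulr0.
Qed.

Lemma dual_leaf_refl p : leaf p p.
Proof. by exists 0, 0, (cst p); split => //; exists [::]. Qed.

Lemma hstep_affine (a c : R) (t0 t1 : R) (I : set R) (d : R -> M) : a != 0 ->
  open I -> `[t0, t1]%classic `<=` I -> smooth_curve I d ->
  (forall t, t0 <= t <= t1 -> horizontal g proj (d t) (velocity d t)) ->
  forall s0 s1, (forall s, s0 <= s <= s1 -> t0 <= a * s + c <= t1) ->
  exists J, [/\ open J, `[s0, s1]%classic `<=` J,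
    smooth_curve J (fun s => d (a * s + c)) &
    forall s, s0 <= s <= s1 -> horizontal g proj (d (a * s + c))
      (velocity (fun s => d (a * s + c)) s)].
Proof.
move=> a0 oI tI sd hd s0 s1 ss.
exists [set s | I (a * s + c)]; split.
- apply: (@open_comp _ _ (fun s : R => a * s + c) I) => // s _.
  by apply: cvgD; [apply: cvgM; [exact: cvg_cst|exact: cvg_id]|exact: cvg_cst].
- by move=> s /= /[!in_itv]/= /ss st; apply: tI; rewrite /= in_itv.
- exact: smooth_curve_affine.
- move=> s /ss st; have Is : I (a * s + c) by apply: tI; rewrite /= in_itv.
  by rewrite (velocity_affine sd Is); apply: horizontalZ; exact: hd.
Qed.

Lemma hstep_sym q q' : hstep q q' -> hstep q' q.
Proof.
move=> [t0 [t1 [I [d [t01 [oI tI] sd hd [d0 d1]]]]]].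
have N1 : (-1 : R) != 0 by rewrite oppr_eq0 oner_neq0.
have [|J [oJ sJ sdJ hJ]] := hstep_affine (a := -1) (c := 0) N1 oI tI sd hd
    (s0 := - t1) (s1 := - t0).
  by move=> s /andP[? ?]; apply/andP; split; lra.
exists (- t1), (- t0), J, (fun s => d (-1 * s + 0)); split => //.
  by rewrite ltrN2.
by rewrite !addr0 !mulN1r !opprK.
Qed.

Lemma dual_leaf_hstep p q q' : leaf p q -> hstep q q' -> leaf p q'.
Proof.
move=> [t0 [t1 [c [[s [ps ls arcs]] c0 c1]]]].
move=> [u0 [u1 [I [d [u01 [oI uI] sd hd [du0 du1]]]]]].
pose t2 := t1 + (u1 - u0).
have t12 : t1 < t2 by rewrite /t2 ltrDl subr_gt0.
have [|J [oJ sJ sdJ hJ]] := hstep_affine (a := 1) (c := u0 - t1)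
   (oner_neq0 R) oI uI sd hd (s0 := t1) (s1 := t2).
  by move=> x; rewrite /t2 => /andP[? ?]; apply/andP; split; lra.
(* The branches agree at [t1], so the new arc is parametrized by [d] on all of [[t1, t2]]; by [st1]
   the old arcs lie entirely in the first branch. *)
pose e t := if t <= t1 then c t else d (1 * t + (u0 - t1)).
have st1 i : (i <= size s)%N -> nth t0 (t0 :: s) i <= t1.
  move=> si; rewrite -ls.
  case: (ltngtP i (size s)) si => // [si _|-> _]; last first.
    by rewrite -[X in nth _ _ X]/(size (t0 :: s)).-1 nth_last.
  have srt : sorted <=%R (t0 :: s).
    by rewrite /=; apply: sub_path ps => x y; exact: ltW.
  rewrite (last_nth t0).
  apply: (sorted_leq_nth le_trans le_refl t0 srt) => //.
  - by rewrite inE/= ltnS ltnW.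
  - by rewrite inE/=.
  - exact: ltnW.
exists t0, t2, e; split.
- exists (rcons s t2); split.
  + by rewrite rcons_path ps ls.
  + by rewrite last_rcons.
  + move=> i; rewrite size_rcons ltnS leq_eqVlt => /orP[/eqP ->|si].
      exists J, (fun s => d (1 * s + (u0 - t1))).
      rewrite nth_rcons ltnn eqxx -rcons_cons nth_rcons /= ltnS leqnn.
      have -> : nth t0 (t0 :: s) (size s) = t1.
        by rewrite -[X in nth _ _ X]/(size (t0 :: s)).-1 nth_last.
      split => // t /andP[tt1 tt2]; split; last by apply: hJ; rewrite tt1.
      rewrite /e; case: ifP => // tle.
      have -> : t = t1 by apply: le_anti; rewrite tle.
      rewrite c1 -du0; congr d; ring.
    have [I' [d' [oI' sI' sd' hd']]] := arcs i si.
    exists I', d'; rewrite nth_rcons si -rcons_cons nth_rcons /= ltnS (ltnW si).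
    split => // t tt; have [ct ht] := hd' t tt; split => //.
    rewrite /e ifT//; have /andP[_ tle] := tt.
    exact: le_trans tle (st1 i.+1 si).
- by rewrite /e (st1 0%N).
- rewrite /e ifF; last by apply/negbTE; rewrite -ltNge.
  by rewrite -du1 /t2; congr d; ring.
Qed.

(** The induction consumes the subdivision from the left, so the start [c t0] moves along and must
    remain in the leaf of [p]. *)
Lemma dual_leaf_ind p (P : M -> Prop) : P p ->
  (forall q q', leaf p q -> P q -> hstep q q' -> P q') ->
  forall q, leaf p q -> P q.
Proof.
move=> Pp IH q [t0 [t1 [c [[s [ps <- arcs]] c0 <-]]]].
rewrite -c0 in Pp; have := dual_leaf_refl p; rewrite -{2}c0.
elim: s t0 ps arcs Pp {c0} => //= u s IHs t0 /andP[t0u ps] arcs Pt0 lt0.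
have step : hstep (c t0) (c u).
  have [I [d [oI sI sd hd]]] := arcs 0%N isT.
  exists t0, u, I, d; split => //; first by move=> t /hd[].
  by split; apply/esym; [have [] := hd t0|have [] := hd u];
    rewrite ?lexx ?(ltW t0u).
apply: (IHs u) => //.
- move=> i si; have := arcs i.+1 si.
  rewrite -[nth t0 (t0 :: _) i.+1]/(nth t0 (u :: s) i) /=.
  rewrite (@set_nth_default _ (u :: s) u t0 i) ?(@set_nth_default _ s u t0 i)//.
  by rewrite /= ltnS ltnW.
- exact: (IH _ _ lt0 Pt0 step).
- exact: (dual_leaf_hstep lt0 step).
Qed.

Lemma dual_leaf_trans p q r : leaf p q -> leaf q r -> leaf p r.
Proof.
move=> pq; apply: (@dual_leaf_ind q (leaf p)) => // x y _ px xy.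
exact: dual_leaf_hstep xy.
Qed.

Lemma dual_leaf_sym p q : leaf p q -> leaf q p.
Proof.
apply: (@dual_leaf_ind p (leaf^~ p)) => [|x y _ xp /hstep_sym xy].
  exact: dual_leaf_refl.
exact: dual_leaf_trans (dual_leaf_hstep (dual_leaf_refl y) xy) xp.
Qed.

Lemma dual_leaf_map (F : M -> M) p q : smooth_map [set: M] F ->
  (forall x u, horizontal g proj x u -> horizontal g proj (F x) (tmap F x u)) ->
  leaf p q -> leaf (F p) (F q).
Proof.
move=> sF hF; apply: (@dual_leaf_ind p (fun q => leaf (F p) (F q))) =>
  [|x y _ px].
  exact: dual_leaf_refl.
move=> [t0 [t1 [I [d [t01 [oI tI] sd hd [d0 d1]]]]]].
apply: (dual_leaf_hstep px); exists t0, t1, I, (F \o d).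
split; [exact: t01|by []|exact: smooth_curve_comp| |by rewrite /= d0 d1].
move=> t tt; have It : I t by apply: tI; rewrite /= in_itv.
rewrite (velocity_comp sF sd It); exact: hF (hd t tt).
Qed.

End Leaves.

(** * Flows of horizontal fields *)

Section FlowLeaf.
Context {R : realType} {n b : nat}.
Context {M : manifoldType R n} {B : manifoldType R b}.
Variables (g : riemannian M) (proj : M -> B).

Definition chart_leaf (p : M) (x y : 'rV[R]_n) :=
  dual_leaf g proj (cinv p x) (cinv p y).

Lemma chart_leaf_trans p x y z :
  chart_leaf p x y -> chart_leaf p y z -> chart_leaf p x z.
Proof. exact: dual_leaf_trans. Qed.

Definition horizontal_in (p : M) (U : set 'rV[R]_n)
    (X : 'rV[R]_n -> 'rV[R]_n) :=
  forall x, U x -> horizontal g proj (cinv p x) (to_tangent p x (X x)).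

Lemma flow_in_leaf (p : M) U X x0 phi r L K :
  open U -> U `<=` cimg p -> smooth_on U X -> horizontal_in p U X ->
  flow_box X U x0 phi r L K ->
  forall q (t : R), `|q - x0| < r -> `|t| < r -> chart_leaf p q (phi t q).
Proof.
move=> oU Up sX hX box q t qr tr.
pose I : set R := [set s | `|s| < r].
have oI : open I.
  apply: (@open_comp _ _ (fun s : R => `|s|) [set x | x < r]).
    by move=> x _; exact: norm_continuous.
  exact: open_lt.
have dphi s : I s -> is_derive (s : R) 1 (phi^~ q) (X (phi s q)).
  by move=> sr; exact: (fb_der box qr sr).
have Uphi s : I s -> U (phi s q) by move=> sr; exact: (fb_in box qr sr).
have sphi : smooth_on (I : set R^o) (phi^~ q : R^o -> 'rV[R]_n).
  by move=> k; exact: (solution_Ck oU oI (sX k) Uphi dphi).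
pose d (s : R) := cinv p (phi s q).
have sd : smooth_curve I d.
  by apply: smooth_curve_chart => // s Is; exact/Up/Uphi.
have hd s : I s -> horizontal g proj (d s) (velocity d s).
  move=> Is; have ps : cdom p (d s) by apply: cinv_dom; exact/Up/Uphi.
  have cd : {for s, continuous d} by exact: sd.1.
  have dp : is_derive s 1 (fun u : R => cmap p (d u)) (X (phi s q)).
    apply: near_eq_is_derive (dphi s Is).
    have : \forall u \near s, I u by exact: open_nbhs_nbhs.
    by apply: filterS => u Iu; rewrite /d cinvK//; exact/Up/Uphi.
  rewrite (velocity_in_chart cd ps dp) /d cinvK; last exact/Up/Uphi.
  exact: (hX _ (Uphi _ Is)).
(* Arcs have positive duration: time 0 is reflexivity, and a negative [t] gives an arc from [t] to
   0, used backwards. *)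
have [t0|t0|t0] := ltgtP 0 t; last first.
- by rewrite -t0 (fb_0 box); exact: dual_leaf_refl.
- apply: dual_leaf_sym; apply: (dual_leaf_hstep (dual_leaf_refl _ _ _)).
  exists t, 0, I, d; split; [exact: t0| |exact: sd| |].
  + split=> // s; rewrite /= in_itv/= /I/= => /andP[ts s0].
    by rewrite ler0_norm// (le_lt_trans _ tr)// ltr0_norm// lerN2.
  + move=> s /andP[ts s0]; apply: hd; rewrite /I/=.
    by rewrite ler0_norm// (le_lt_trans _ tr)// ltr0_norm// lerN2.
  + by rewrite /d (fb_0 box).
- apply: (dual_leaf_hstep (dual_leaf_refl _ _ _)).
  exists 0, t, I, d; split; [exact: t0| |exact: sd| |].
  + split=> // s; rewrite /= in_itv/= /I/= => /andP[s0 st].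
    by rewrite ger0_norm// (le_lt_trans _ tr)// gtr0_norm.
  + move=> s /andP[s0 st]; apply: hd; rewrite /I/=.
    by rewrite ger0_norm// (le_lt_trans _ tr)// gtr0_norm.
  + by rewrite /d (fb_0 box).
Qed.

(** Packages the input of the bracket argument, so that the frame and arbitrary horizontal
    extensions are treated alike. *)
Definition has_flow (p : M) (X : 'rV[R]_n -> 'rV[R]_n) :=
  exists U phi r L K, [/\ U (cmap p p), open U, smooth_on U X,
    flow_box X U (cmap p p) phi r L K &
    forall q (t : R), `|q - cmap p p| < r -> `|t| < r ->
      chart_leaf p q (phi t q)].

Lemma horizontal_has_flow p U X : open U -> U (cmap p p) -> U `<=` cimg p ->
  smooth_on U X -> horizontal_in p U X -> has_flow p X.
Proof.
move=> oU U0 Up sX hX.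
have sd := C1_strict_diff oU (sX 1%N) U0.
have [phi [r [L [K box]]]] := flow_box_exists sd oU U0.
by exists U, phi, r, L, K; split => //; exact: (flow_in_leaf oU Up sX hX box).
Qed.

Lemma has_flow_attain p X : has_flow p X ->
  attain (chart_leaf p) (cmap p p) (X (cmap p p)).
Proof.
move=> [U [phi [r [L [K [_ _ _ box H]]]]]]; exact: (attain_flow box H).
Qed.

Lemma has_flow_bracket p X Y : has_flow p X -> has_flow p Y ->
  attain (chart_leaf p) (cmap p p)
    ('D_(X (cmap p p)) Y (cmap p p) - 'D_(Y (cmap p p)) X (cmap p p)).
Proof.
move=> [U [phi [r [L [K [U0 oU sX box H]]]]]].
move=> [U' [phi' [r' [L' [K' [U0' oU' sY box' H']]]]]].
have sdX := C1_strict_diff oU (sX 1%N) U0.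
have sdY := C1_strict_diff oU' (sY 1%N) U0'.
have [dX _] := sX 1%N; have [dY _] := sY 1%N.
rewrite (deriveEjacobian _ (dY _ U0')) (deriveEjacobian _ (dX _ U0)).
(* [attain_bracket] conjugates its second field by its first, so [Y] goes first to give the sign of
   [lie_bracket]. *)
exact: (attain_bracket (@chart_leaf_trans p) sdY sdX box' box H' H).
Qed.

End FlowLeaf.

(** * The horizontal frame and the O'Neill tensor *)

Section Bilin.
Context {R : realType}.

Lemma bilinE n (A : 'M[R]_n) u v : bilin A u v = (u *m A *m v^T) 0 0.
Proof. by []. Qed.

Lemma bilin_eq0 n (A : 'M[R]_n) :
  (forall u : 'rV_n, u != 0 -> 0 < bilin A u u) ->
  forall u, bilin A u u = 0 -> u = 0.
Proof.
move=> Apos u Au; apply/eqP; apply: contraTT isT => /Apos.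
by rewrite Au ltxx.
Qed.

Lemma posdef_det_neq0 n (A : 'M[R]_n) :
  (forall u : 'rV_n, u != 0 -> 0 < bilin A u u) -> \det A != 0.
Proof.
move=> Apos; rewrite -unitfE -unitmxE -row_free_unit.
apply: inj_row_free => v vA; apply: (bilin_eq0 Apos).
by rewrite /bilin vA mul0mx mxE.
Qed.

(* The form [y |-> y *m \adj G *m y^T] is definite when G is. *)
Lemma frame_unit n b (G : 'M[R]_n) (J : 'M[R]_(n, b)) : G^T = G ->
  (forall u : 'rV_n, u != 0 -> 0 < bilin G u u) ->
  (forall w : 'rV_b, exists u, u *m J = w) ->
  J^T *m \adj G *m J \in unitmx.
Proof.
move=> Gsym Gpos Jsurj; rewrite -row_free_unit; apply: inj_row_free => w wJ.
have dG := posdef_det_neq0 Gpos.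
pose y := w *m J^T; pose z := y *m \adj G.
have zG : z *m G = \det G *: y by rewrite /z -mulmxA mul_adj_mx mul_mx_scalar.
have zy : z *m y^T = 0.
  by rewrite /z /y trmx_mul trmxK !mulmxA in wJ *; rewrite wJ mul0mx.
have yz : y *m z^T = 0 by rewrite -[LHS]trmxK trmx_mul trmxK zy trmx0.
have z0 : z = 0.
  apply: (bilin_eq0 Gpos).
  by rewrite /bilin zG -scalemxAl yz scaler0 mxE.
have y0 : y = 0.
  have : \det G *: y = 0 by rewrite -zG z0 mul0mx.
  by move/eqP; rewrite scaler_eq0 (negbTE dG) => /eqP.
(* Since [J] is onto, a vector over the [j]-th basis vector reads [w 0 j] off the relation
   [y = 0]. *)
apply/rowP => j; have [u uJ] := Jsurj (delta_mx 0 j).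
have : (u *m y^T) 0 0 = 0 by rewrite y0 trmx0 mulmx0 mxE.
rewrite /y trmx_mul trmxK mulmxA uJ -rowE !mxE => ->//.
Qed.

End Bilin.

Section Frame.
Context {R : realType} {n b : nat}.
Context {M : manifoldType R n} {B : manifoldType R b}.
Variables (g : riemannian M) (proj : M -> B).
Hypothesis sproj : smooth_map [set: M] proj.
Variable p : M.

Let x0 := cmap p p.
Let F := chart_map proj p (proj p).
Let D := chart_map_dom proj p (proj p).

Let oD : open D. Proof. exact: chart_map_dom_open. Qed.
Let Dx0 : D x0.
Proof. by split; [exact: cimg_self|rewrite cinv_self; exact: cdom_self]. Qed.
Let Dp : D `<=` cimg p. Proof. by move=> x []. Qed.

(* The rows of [frame x] span the horizontal space, which is the orthogonal
   complement of the kernel of [jacobian F x].  The adjugate replaces the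
   inverse of the Gram matrix, so that smoothness is polynomial in the
   entries. *)
Definition frame (x : 'rV[R]_n) : 'M[R]_(b, n) :=
  (jacobian F x)^T *m \adj (form_in g p x).

Lemma jacobian_smooth k : Ck k D (jacobian F).
Proof.
have [dF DF] := chart_map_smooth sproj p (proj p) k.+1.
apply: Ck_mxP => // i j.
apply: (Ck_eq oD _ (Ck_coord 0 j oD (DF (delta_mx 0 i)))) => x Dx.
have -> := deriveEjacobian (delta_mx 0 i) (dF x Dx).
by rewrite -rowE mxE.
Qed.

Lemma frame_smooth k : Ck k D frame.
Proof.
apply: Ck_mulmx => //; first exact/Ck_trmx/jacobian_smooth.
by apply: Ck_adj => //; apply: Ck_subset (gram_smooth g p k).
Qed.

Lemma inner_to_tangent x u v : 
  inner g (cinv p x) (to_tangent p x u) (to_tangent p x v) =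
  bilin (form_in g p x) u v.
Proof.
rewrite /inner /bilin /form_in /= -[to_tangent p x u](mul_rV_lin1 _ u).
rewrite -[to_tangent p x v](mul_rV_lin1 _ v) trmx_mul !mulmxA.
by [].
Qed.

Lemma vertical_in_chart x v : D x ->
  vertical proj (cinv p x) (to_tangent p x v) -> v *m jacobian F x = 0.
Proof.
move=> Dx; rewrite /vertical /= => tv.
rewrite /jacobian mul_rV_lin1.
have := diff_chart_map sproj v Dx; rewrite tv linear0; exact.
Qed.

(** With [J] the jacobian and [u *m J = 0], the product [w *m J^T *m \adj G *m G *m u^T] is [\det G]
    times [w *m (u *m J)^T], hence zero. *)
Lemma frame_horizontal w : horizontal_in g proj p D (fun x => w *m frame x).
Proof.
move=> x Dx v vert.
have px := Dp Dx; rewrite -(of_tangentK v px) in vert *.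
move: (of_tangent p x v) vert => u /(vertical_in_chart Dx) uJ.
rewrite inner_to_tangent bilinE /frame; move: (form_in g p x) => G.
rewrite !mulmxA -(mulmxA _ (\adj G)) mul_adj_mx.
rewrite mul_mx_scalar -scalemxAl -mulmxA -trmx_mul uJ trmx0 mulmx0.
by rewrite scaler0 mxE.
Qed.

Lemma frame_has_flow w : has_flow g proj p (fun x => w *m frame x).
Proof.
apply: (horizontal_has_flow oD) => //; last exact: frame_horizontal.
by move=> k; apply: Ck_mulmx => //; [exact: Ck_cst|exact: frame_smooth].
Qed.

Lemma frame_attain : attain (chart_leaf g proj p) x0 (frame x0).
Proof.
apply: attain_rows => [x|x y z|i].
- exact: dual_leaf_refl.
- exact: chart_leaf_trans.
have := has_flow_attain (frame_has_flow (delta_mx 0 i)).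
by rewrite -rowE.
Qed.

Hypothesis proj_submersion : forall w, exists u, tmap proj p u = w.

Lemma form_in_self : form_in g p x0 = g p.
Proof.
apply/matrixP => i j.
have E u v : bilin (form_in g p x0) u v = bilin (g p) u v.
  by rewrite -inner_to_tangent !to_tangent_self cinv_self.
have := E (delta_mx 0 i) (delta_mx 0 j).
by rewrite !bilinE -!rowE !trmx_delta -!colE !mxE.
Qed.

(** The matrix form of the fact that the span of the frame at [p] projects isomorphically onto the
    tangent space of the base. *)
Lemma frame_jacobian_unit : frame x0 *m jacobian F x0 \in unitmx.
Proof.
rewrite /frame form_in_self; apply: frame_unit.
- exact: gram_sym.
- exact: gram_posdef.
- move=> w; have [u <-] := proj_submersion w.
  by exists u; rewrite /jacobian mul_rV_lin1.
Qed.

(** An instance of [attain_open] with [Pi] the projection in charts. The set [N] keeps the witnesses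
    near [p], where [leaf_nbhs] controls their fiber coordinate. *)
Lemma proj_leaf_nbhs N : nbhs p N ->
  nbhs (proj p) (proj @` [set q | N q /\ dual_leaf g proj p q]).
Proof.
move=> nN.
pose N' := [set x | cimg p x /\ (N `&` proj @^-1` cdom (proj p)) (cinv p x)].
have nN' : nbhs x0 N'.
  apply: cinv_nbhs; first exact: cimg_self.
  rewrite cinv_self; apply: filterI => //.
  apply: (smooth_map_continuous sproj); apply: open_nbhs_nbhs.
  by split; [exact: cdom_open|exact: cdom_self].
have sF : strict_diff F x0 (jacobian F x0).
  exact: (C1_strict_diff oD (chart_map_smooth sproj p (proj p) 1%N) Dx0).
have CAJ : invmx (frame x0 *m jacobian F x0) *m frame x0 *m jacobian F x0 =
    1%:M.
  by rewrite -mulmxA mulVmx// frame_jacobian_unit.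
have H := attain_open frame_attain sF CAJ nN'.
have Fx0 : F x0 = cmap (proj p) (proj p) by rewrite /F /chart_map cinv_self.
rewrite Fx0 in H.
have := cmap_continuous _ _ (cdom_self (proj p)) _ H.
have pd : nbhs (proj p) (cdom (proj p)).
  by apply: open_nbhs_nbhs; split; [exact: cdom_open|exact: cdom_self].
apply: filterS2 pd => y py [x [[px [Nx rx]] lx] Fxy].
exists (cinv p x).
  by split => //; move: lx; rewrite /chart_leaf cinv_self.
by rewrite -(cmapK _ _ py) -Fxy /F /chart_map cmapK.
Qed.

(** * Attaining every direction when the O'Neill map is onto *)

Section Onto.
Hypothesis Aonto : oneill_onto g proj p.

Let att (v : 'rV[R]_n) := attain (chart_leaf g proj p) x0 v.

Let attD u v : att u -> att v -> att (u + v).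
Proof. by apply: attainD; exact: chart_leaf_trans. Qed.

Let attB u v : att u -> att v -> att (u - v).
Proof.
by move=> au av; apply: attD => //; rewrite -scaleN1r; exact: attainZ.
Qed.

Let att0 : att 0. Proof. by apply: attain0 => x; exact: dual_leaf_refl. Qed.

Let vertical_jacobian v : v *m jacobian F x0 = 0 -> vertical proj p v.
Proof. by rewrite /jacobian mul_rV_lin1. Qed.

Let frame_part (u : 'rV[R]_n) : exists2 w : 'rV[R]_b,
  vertical proj p (u - w *m frame x0) & horizontal g proj p (w *m frame x0).
Proof.
exists (u *m jacobian F x0 *m invmx (frame x0 *m jacobian F x0)).
  apply: vertical_jacobian; rewrite mulmxBl -(mulmxA _ (frame x0)).
  by rewrite -[X in _ - X]mulmxA mulVmx ?frame_jacobian_unit// mulmx1 subrr.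
set w := _ *m invmx _.
by have := frame_horizontal w Dx0; rewrite to_tangent_self cinv_self.
Qed.

(** The difference of [u] and its frame part is both vertical and orthogonal to vertical vectors, so
    [u] is a combination of the frame. *)
Lemma horizontal_attain u : horizontal g proj p u -> att u.
Proof.
move=> hu; have [w vert hw] := frame_part u.
have uw : u - w *m frame x0 = 0.
  apply: (bilin_eq0 (gram_posdef g p)).
  have := hu _ vert; have := hw _ vert; rewrite /inner /bilin => hw0 hu0.
  by rewrite !mulmxBl mxE hu0 mxE [X in - X]hw0 subr0.
by rewrite (subr0_eq uw); apply: attain_lin; exact: frame_attain.
Qed.

Lemma extension_has_flow u X : horizontal_extension g proj p u X ->
  has_flow g proj p (field_in p X).
Proof.
move=> [_ [W [[oW Wp] sX hX]]].
apply: (@horizontal_has_flow _ _ _ _ _ _ _ _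
  [set x | cimg p x /\ W (cinv p x)]).
- exact: open_chart_domain.
- by split; [exact: cimg_self|rewrite cinv_self].
- by move=> x [].
- exact: sX.
- move=> x [px Wx].
  have -> : to_tangent p x (field_in p X x) = X (cinv p x).
    exact: (of_tangentK _ px).
  exact: (hX _ Wx).
Qed.

(** The vertical part differs from [z] by a horizontal vector, and the default 0 of [xget] is
    attained as well. *)
Lemma vertical_part_attain z : att z -> att (vertical_part g proj p z).
Proof.
move=> az; rewrite /vertical_part.
case: xgetP => [v _ [_ hv]|_]; last exact: att0.
by rewrite -(subKr z v); apply: attB => //; exact: horizontal_attain.
Qed.

(** Whichever extensions [xget] picks, their bracket at [p] is attained. [vertical_attain] treats
    the chosen decomposition of a bivector in the same way. *)
Lemma oneill_attain u v : att (oneill g proj p u v).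
Proof.
rewrite /oneill; case: xgetP => [z _ [X [Y [hX hY ->]]]|_]; last exact: att0.
apply: vertical_part_attain.
exact: (has_flow_bracket (extension_has_flow hX) (extension_has_flow hY)).
Qed.

Lemma vertical_attain v : vertical proj p v -> att v.
Proof.
move=> /Aonto[w _ <-]; rewrite /oneill_wedge.
case: xgetP => [z _ [s [_ _ ->]]|_]; last exact: att0.
elim: s => [|z0 s IH]; first by rewrite big_nil; exact: att0.
by rewrite big_cons; apply: attD => //; exact: oneill_attain.
Qed.

Lemma all_attain u : att u.
Proof.
have [w vert hw] := frame_part u.
rewrite -(subrK (w *m frame x0) u); apply: attD; first exact: vertical_attain.
exact: horizontal_attain.
Qed.

Lemma onto_leaf_nbhs : nbhs p (dual_leaf g proj p).
Proof.
have aI : attain (chart_leaf g proj p) x0 (1%:M : 'M[R]_n).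
  apply: attain_rows => [x|x y z|i].
  - exact: dual_leaf_refl.
  - exact: chart_leaf_trans.
  - exact: all_attain.
have nC : nbhs x0 (cimg p : set 'rV[R]_n).
  by apply: open_nbhs_nbhs; split; [exact: cimg_open'|exact: cimg_self].
have I1 : (1%:M : 'M[R]_n) *m 1%:M *m 1%:M = 1%:M by rewrite !mulmx1.
have H := attain_open aI (strict_diff_id x0) I1 nC.
have := cmap_continuous _ _ (cdom_self p) _ H.
have pd : nbhs p (cdom p).
  by apply: open_nbhs_nbhs; split; [exact: cdom_open|exact: cdom_self].
apply: filterS2 pd => y py [x [px lx] xy].
by move: lx; rewrite /chart_leaf cinv_self xy cmapK.
Qed.

End Onto.

End Frame.

(** * The action of the structure group *)

Section PrincipalBundle.
Context {R : realType} {n b k : nat} {M : manifoldType R n}.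
Context {B : manifoldType R b} {G : lieGroupType R k}.
Variables (act : M -> G -> M) (proj : M -> B) (g : riemannian M).
Hypothesis bundle : principal_bundle act proj.
Hypothesis invariant : invariant_metric act g.

Let leaf := dual_leaf g proj.

Lemma act_continuous2 m a :
  {for (m, a), continuous (fun z : M * G => act z.1 z.2)}.
Proof. exact: (pb_act_smooth bundle).1. Qed.

Lemma act_smooth a : smooth_map [set: M] (act^~ a).
Proof.
have [_ sact] := pb_act_smooth bundle; split=> [m _|p r l].
  apply: (@continuous_comp _ _ _ (fun m => (m, a))
    (fun z : M * G => act z.1 z.2)); last exact: act_continuous2.
  by apply: cvg_pair; [exact: cvg_id|exact: cvg_cst].
(* This affine map freezes the group coordinate at [a], in the preferred chart there. *)
pose h (x : 'rV[R]_n) : 'rV[R]_n * 'rV[R]_k := (x, cmap a a).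
have dh x : differentiable h x.
  by apply: differentiable_pair; [exact: ex_diff|exact: differentiable_cst].
have hl x v (t : R) : h (t *: v + x) = t *: (v, 0) + h x.
  by rewrite /h; congr pair; rewrite /= scaler0 add0r.
have := Ck_affine dh hl (sact p a r l).
have -> : (fun z => cmap r (act (cinv p z.1) (cinv a z.2))) \o h =
    fun x => cmap r (act (cinv p x) a).
  by apply/funext => x; rewrite /h /= cinv_self.
apply: Ck_subset => x [px _ rx]; rewrite /h /=; split => //.
- by split => //; exact: cimg_self.
- by rewrite cinv_self.
Qed.

Lemma actK a m : act (act m a) a^-1%g = m.
Proof. by rewrite -(pb_actM bundle) mulgV (pb_act1 bundle). Qed.

Lemma actVK a m : act (act m a^-1%g) a = m.
Proof. by rewrite -(pb_actM bundle) mulVg (pb_act1 bundle). Qed.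

Lemma tmap_id p (v : 'rV[R]_n) : tmap (id : M -> M) p v = v.
Proof. exact: (diff_transit_id v (cimg_self p)). Qed.

Lemma proj_tmap_act a m v :
  tmap proj (act m a) (tmap (act^~ a) m v) = tmap proj m v.
Proof.
have := tmap_comp m v (act_smooth a) (pb_smooth bundle).
have -> : proj \o act^~ a = proj.
  by apply/funext => x; exact: (pb_act_fiber bundle).
exact: esym.
Qed.

Lemma tmap_actVK a m v :
  tmap (act^~ a) m (tmap (act^~ a^-1%g) (act m a) v) = v.
Proof.
have := tmap_comp (act m a) v (act_smooth a^-1%g) (act_smooth a).
have -> : (act^~ a) \o (act^~ a^-1%g) = id.
  by apply/funext => x; rewrite /= actVK.
by rewrite tmap_id actK => <-.
Qed.

Lemma horizontal_act a m u : horizontal g proj m u ->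
  horizontal g proj (act m a) (tmap (act^~ a) m u).
Proof.
(* Every vector at [act m a] is the image of one at [m] by the inverse action, so verticality and
   inner products can be tested at [m]. *)
move=> hu v; rewrite -(tmap_actVK a m v); move: (tmap _ (act m a) v) => w.
rewrite /vertical /= proj_tmap_act => vw.
by rewrite (invariant a m u w); exact: hu.
Qed.

Lemma leaf_act a p q : leaf p q -> leaf (act p a) (act q a).
Proof.
apply: (dual_leaf_map (act_smooth a)) => x u; exact: horizontal_act.
Qed.

(** Gives the group element between two points of a fiber by a formula that is continuous in both
    points, as [leaf_nbhs] requires. *)
Lemma trivialization_act U h s m m' :
  local_trivialization act proj U h s -> U (proj m) -> proj m = proj m' ->
  act m ((h m)^-1 * h m')%g = m'.
Proof.
move=> triv Um mm'; rewrite -[RHS](lt_invK triv) -?mm'//.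
rewrite -[LHS](lt_invK triv) (pb_act_fiber bundle)//.
by rewrite (lt_equivariant triv)// mulVKg.
Qed.

Lemma fiber_transitive m m' : proj m = proj m' -> exists a, act m a = m'.
Proof.
move=> mm'; have [U [h [s [[_ Um] triv]]]] := pb_trivial bundle (proj m).
by exists ((h m)^-1 * h m')%g; exact: (trivialization_act triv Um mm').
Qed.

Hypothesis Mconnected : connected [set: M].

Lemma clopen_full (S : set M) p : S p -> (forall m, S m -> nbhs m S) ->
  (forall m, ~ S m -> nbhs m (~` S)) -> S = setT.
Proof.
move=> Sp oS cS; apply: Mconnected; first by exists p.
- by exists S; rewrite ?setTI// openE => m; exact: oS.
- exists S; rewrite ?setTI//; rewrite -[S]setCK; apply: open_closedC.
  by rewrite openE => m; exact: cS.
Qed.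

Hypothesis proj_submersion : forall m w, exists u, tmap proj m u = w.

(* The points joined to the fiber of [p] form a saturated clopen set. *)
Lemma fiber_reachable p m : exists a, leaf m (act p a).
Proof.
pose S := [set m | exists a, leaf m (act p a)].
suff : S = setT by move=> ST; have : S m by rewrite ST.
have S_proj m1 m2 : proj m1 = proj m2 -> S m1 -> S m2.
  move=> /fiber_transitive[a <-] [c mc]; exists (c * a)%g.
  by rewrite (pb_actM bundle); exact: leaf_act.
have S_leaf m1 m2 : leaf m1 m2 -> S m1 -> S m2.
  move=> m12 [a m1a]; exists a; apply: dual_leaf_trans m1a.
  exact: dual_leaf_sym.
have near_m m1 : \forall m2 \near m1, exists2 q, leaf m1 q & proj q = proj m2.
  have nT : nbhs m1 setT by exact: filterT.
  have H := proj_leaf_nbhs g (pb_smooth bundle) (proj_submersion m1) nT.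
  have H' : \forall m2 \near m1,
      (proj @` [set q | setT q /\ leaf m1 q]) (proj m2).
    exact: (smooth_map_continuous (pb_smooth bundle) H).
  by apply: filterS H' => m2 [q [_ ?] ?]; exists q.
apply: (@clopen_full S p).
- exists 1%g; rewrite (pb_act1 bundle); exact: dual_leaf_refl.
- move=> m1 Sm1; apply: filterS (near_m m1) => m2 [q mq /S_proj]; apply.
  exact: S_leaf Sm1.
- move=> m1 Sm1; apply: filterS (near_m m1) => m2 [q mq /esym/S_proj qm Sm2].
  by apply/Sm1/(S_leaf q); [exact: dual_leaf_sym|exact: qm].
Qed.

(* If [q] is joined to [act p c], then [act q a] lies in the leaf of [q] as soon
   as [act p (c * a * c^-1)] lies in the leaf of [p]. *)
Lemma holonomy_nbhs p : nbhs p (leaf p) ->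
  forall q, \forall a \near (1%g : G), leaf q (act q a).
Proof.
move=> nLp q; have [c qc] := fiber_reachable p q.
have cont (m : M) (a : G) : {for a, continuous (act m)}.
  apply: (@continuous_comp _ _ _ (fun a => (m, a))
    (fun z : M * G => act z.1 z.2)); last exact: act_continuous2.
  by apply: cvg_pair; [exact: cvg_cst|exact: cvg_id].
have H : {for (1%g : G), continuous (fun a => act (act (act p c) a) c^-1%g)}.
  apply: (@continuous_comp _ _ _ (act (act p c)) (act^~ c^-1%g)).
    exact: cont.
  exact: (smooth_map_continuous (act_smooth _)).
have H1 : nbhs (act (act (act p c) 1%g) c^-1%g) (leaf p).
  by rewrite (pb_act1 bundle) actK.
have H2 : \forall a \near (1%g : G), leaf p (act (act (act p c) a) c^-1%g).
  exact: (H _ H1).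
apply: filterS H2 => a /(leaf_act c); rewrite actVK => pa.
apply: (dual_leaf_trans qc); apply: (dual_leaf_trans pa).
by apply: leaf_act; exact: dual_leaf_sym.
Qed.

(** For [m] near [q], some [q'] near [q] lies both in the leaf of [q] and in the fiber of [m], and
    [m] is [act q' a] with [a] near 1. Then [act q a] is in the leaf of [q], and translating the
    curve from [q] to [q'] by [a] joins [act q a] to [m]. *)
Lemma leaf_nbhs p : nbhs p (leaf p) -> forall q, nbhs q (leaf q).
Proof.
move=> /holonomy_nbhs hol q.
have [U [h [s [[oU Uq] triv]]]] := pb_trivial bundle (proj q).
have ch : {for q, continuous h} by exact: (lt_smooth triv).1.
have cont : {for (q, q), continuous (fun z : M * M => (h z.1)^-1 * h z.2)%g}.
  apply: (@continuous_comp _ _ _ (fun z : M * M => ((h z.1)^-1, h z.2)%g)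
    (fun z : G * G => (z.1 * z.2)%g)); last first.
    exact: (@mulg_smooth R k G).1.
  apply: cvg_pair.
    apply: (@continuous_comp _ _ _ (fun z : M * M => h z.1)
      (fun x : G => x^-1%g)).
      by apply: (@continuous_comp _ _ _ fst h) => //; exact: cvg_fst.
    exact: (@invg_smooth R k G).1.
  by apply: (@continuous_comp _ _ _ snd h) => //; exact: cvg_snd.
have H1 : nbhs ((h q)^-1 * h q)%g [set a | leaf q (act q a)].
  by rewrite mulVg; exact: hol.
have [[N1 N2] [/= nN1 nN2] N12] := cont _ H1.
have nU : nbhs q (proj @^-1` U).
  by apply: (smooth_map_continuous (pb_smooth bundle)); exact: open_nbhs_nbhs.
have nN : nbhs q (N1 `&` proj @^-1` U) by exact: filterI.
have H2 := proj_leaf_nbhs g (pb_smooth bundle) (proj_submersion q) nN.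
have H3 : \forall m \near q, (proj @` [set q' | (N1 `&` proj @^-1` U) q' /\
    leaf q q']) (proj m).
  exact: (smooth_map_continuous (pb_smooth bundle) H2).
apply: filterS2 nN2 H3 => m N2m [q' [[N1q' Uq'] qq'] pq'].
have : leaf q (act q ((h q')^-1 * h m)%g) by exact: (N12 (q', m)).
move=> /dual_leaf_trans; apply.
have := leaf_act ((h q')^-1 * h m)%g qq'.
by rewrite (trivialization_act triv Uq' pq').
Qed.

Lemma leaf_full p : nbhs p (leaf p) -> forall q, leaf q = setT.
Proof.
move=> /leaf_nbhs nL q; apply: (@clopen_full _ q).
- exact: dual_leaf_refl.
- move=> m qm; apply: filterS (nL m) => x; exact: dual_leaf_trans.
- move=> m qm; apply: filterS (nL m) => x mx qx; apply: qm.
  by apply: (dual_leaf_trans qx); exact: dual_leaf_sym.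
Qed.

End PrincipalBundle.

Theorem corollary2 (R : realType) (n b k : nat) (M : manifoldType R n)
    (B : manifoldType R b) (G : lieGroupType R k)
    (act : M -> G -> M) (proj : M -> B)
    (gM : riemannian M) (gB : riemannian B)
    (Mconnected : connected [set: M])
    (bundle : principal_bundle act proj)
    (invariant : invariant_metric act gM)
    (complete : complete_metric gM)
    (nonneg : nonneg_sectional gM)
    (submersion : riemannian_submersion gM gB proj)
    (onto : exists p, oneill_onto gM proj p) :
  twisted gM proj.
Proof.
have [p Aonto] := onto.
have sub m w : exists u, tmap proj m u = w by exact: (rs_submersion submersion).
have nLp := onto_leaf_nbhs (pb_smooth bundle) (sub p) Aonto.
have full := leaf_full bundle invariant Mconnected sub nLp.
exists setT; rewrite /dual_foliation; apply/seteqP; split.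
  by move=> _ [q _ <-]; exact: full.
by move=> _ ->; exists p => //; exact: full.
Qed.
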